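(* Let $(x_k,y_k)\in\mathbb{Z}^d\times\mathbb{Z}^d$ $(1\le k\le N-1)$, let $(\alpha,\beta)\in(\mathbb{R}^d\times\mathbb{R}^d)\setminus(\mathbb{Z}^d\times\mathbb{Z}^d)$, and let $\Lambda=\{(x_k,y_k):1\le k\le N-1\}\cup\{(\alpha,\beta)\}$. Assume that $0\ne f\in\mathcal{S}(\mathbb{R}^d)$ and $c_1,\dots,c_{N-1}\in\mathbb{C}$ satisfy $$\sum_{k=1}^{N-1}c_kM_{y_k}T_{x_k}f=M_\beta T_\alpha f. \qquad ( * )$$ Let $\gamma=(-\alpha,\beta)$ and $H=\overline{\{n\gamma \bmod \mathbb{Z}^{2d}:n\in\mathbb{Z}\}}\subset\mathbb{T}^{2d}$. Then exactly one of the following three alternatives occurs. (i) Dense-orbit case: $H=\mathbb{T}^{2d}$. This case is impossible. (ii) Finite-orbit case: $H$ is finite. In this case $(\alpha,\beta)\in\mathbb{Q}^{2d}\setminus\mathbb{Z}^{2d}$, the set $\Lambda$ is contained in a full-rank lattice in $\mathbb{R}^{2d}$, and therefore (by Linnell's theorem) $f=0$. (iii) Infinite proper case: $H$ is infinite and $H\neq\mathbb{T}^{2d}$. In this case $S=\{z\in\mathbb{T}^{2d}: F(z)\ne0\}$ is a nonempty open $H$-invariant subset of $\mathbb{T}^{2d}$, and the function $$\Theta(z)=\int_H\log|p(z+h)|\,dm_H(h)$$ is well defined on $S$ and satisfies, for every $z\in S$, $$\lim_{n\to\infty}\frac{\log F(z+n\gamma)-\log F(z)}{n}=\Theta(z)\qquad\text{and}\qquad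 \Theta(z)=0.$$ In particular, if a nonzero $f\in\mathcal{S}(\mathbb{R}^d)$ satisfies a relation $( * )$ (a nontrivial mixed-integer counterexample to the HRT conjecture with Schwartz window), then it must belong to the infinite proper case (iii) and satisfy $\Theta\equiv0$ on $S$.
   Context: Here $d\ge1$, $N\ge2$ are integers, $\langle\cdot,\cdot\rangle$ is the standard inner product on $\mathbb{R}^d$, and $\mathcal{S}(\mathbb{R}^d)$ is the Schwartz space (complex-valued functions). $\mathbb{T}^n=\mathbb{R}^n/\mathbb{Z}^n$; periodic functions on $\mathbb{R}^n$ are identified with functions on $\mathbb{T}^n$, and $z+n\gamma$ for $z\in\mathbb{T}^{2d}$ means addition of the class of $n\gamma$. Time-frequency shifts: $T_xf(t)=f(t-x)$, $M_yf(t)=e^{-2\pi i\langle y,t\rangle}f(t)$. Zak transform: $Zf(t,\omega)=\sum_{\kappa\in\mathbb{Z}^d}e^{-2\pi i\langle\omega,\kappa\rangle}f(t+\kappa)$ for $(t,\omega)\in\mathbb{R}^d\times\mathbb{R}^d$. Its modulus $F:=|Zf|$ is $\mathbb{Z}^{2d}$-periodic and is regarded as a continuous function on $\mathbb{T}^{2d}$. Trigonometric polynomial of the relation $( * )$: $p(t,\omega)=\sum_{k=1}^{N-1}c_ke^{-2\pi i\langle y_k,t\rangle}e^{-2\pi i\langle\omega,x_k\rangle}$, regarded as a function on $\mathbb{T}^{2d}$. $H$ is a closed subgroup of $\mathbb{T}^{2d}$ and $m_H$ is its normalized Haar measure. $H$-invariant means $S+H\subset S$. Linnell's theorem: if $g\in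 L^2(\mathbb{R}^d)$ is nonzero and a finite set of distinct points is contained in a full-rank lattice of $\mathbb{R}^{2d}$, then the functions $M_yT_xg$, with $(x,y)$ in that set, are linearly independent. *)

(* Defs.v *)
From HB Require Import structures.
From mathcomp Require Import all_boot all_order all_algebra.
From mathcomp Require Import generic_quotient ring_quotient.
From mathcomp Require Import finmap complex.
From mathcomp Require Import all_classical all_reals all_analysis.
From mathcomp.analysis.showcase Require summability.

Set Implicit Arguments.
Unset Strict Implicit.
Unset Printing Implicit Defensive.

Import Order.TTheory GRing.Theory Num.Theory.
Import numFieldNormedType.Exports.

Local Open Scope classical_set_scope.
Local Open Scope ring_scope.
Local Open Scope complex_scope.

Definition dot (R : realType) (d : nat) (u v : 'rV[R]_d) : R :=
  \sum_(i < d) u 0 i * v 0 i.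

(* expi s is e^{2 pi i s}. *)
Definition expi (R : realType) (s : R) : R[i] :=
  cos (2 * pi * s) +i* sin (2 * pi * s).

(* The modulus as a real number; the norm `|z| of z : R[i] has type R[i]. *)
Definition cmod (R : realType) (z : R[i]) : R := ComplexField.Normc.normc z.

Definition translation (R : realType) (d : nat) (x : 'rV[R]_d)
    (f : 'rV[R]_d -> R[i]) : 'rV[R]_d -> R[i] :=
  fun t => f (t - x).

Definition modulation (R : realType) (d : nat) (y : 'rV[R]_d)
    (f : 'rV[R]_d -> R[i]) : 'rV[R]_d -> R[i] :=
  fun t => expi (- dot y t) * f t.

Definition int_vec (R : realType) (d : nat) (k : 'rV[int]_d) : 'rV[R]_d :=
  map_mx intr k.

(* Iterated partial derivative of a real function along the coordinate
   directions listed in s. *)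
Definition partials (R : realType) (d : nat) (s : seq 'I_d)
    (g : 'rV[R]_d -> R) : 'rV[R]_d -> R :=
  foldr (fun (i : 'I_d) (h : 'rV[R]_d -> R) x => 'D_(delta_mx 0 i) h x) g s.

Definition smooth (R : realType) (d : nat) (g : 'rV[R]_d -> R) : Prop :=
  forall s : seq 'I_d, continuous (partials s g) /\
    forall (i : 'I_d) (x : 'rV[R]_d), derivable (partials s g) x (delta_mx 0 i).

Definition real_schwartz (R : realType) (d : nat) (g : 'rV[R]_d -> R) : Prop :=
  smooth g /\
  forall (a : 'I_d -> nat) (s : seq 'I_d), exists C : R,
    forall x : 'rV[R]_d, `|(\prod_(i < d) x 0 i ^+ a i) * partials s g x| <= C.

Definition schwartz (R : realType) (d : nat) (f : 'rV[R]_d -> R[i]) : Prop :=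
  real_schwartz (fun x => complex.Re (f x)) /\
  real_schwartz (fun x => complex.Im (f x)).

(* Unconditional sum over Z^d (limit of the net of finite partial sums), taken
   on real and imaginary parts. *)
Definition csum (R : realType) (d : nat) (u : 'rV[int]_d -> R[i]) : R[i] :=
  (summability.sum (fun k => complex.Re (u k) : R^o) : R) +i*
  (summability.sum (fun k => complex.Im (u k) : R^o) : R).

Definition zak (R : realType) (d : nat) (f : 'rV[R]_d -> R[i])
    (t w : 'rV[R]_d) : R[i] :=
  csum (fun k : 'rV[int]_d =>
    expi (- dot w (int_vec R k)) * f (t + int_vec R k)).

Definition integer_points (R : realType) (n : nat) (v : 'rV[R]_n) : bool :=
  [forall i, v 0 i \is a Num.int].

Lemma integer_points_zmod_closed (R : realType) (n : nat) :
  zmod_closed (@integer_points R n).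
Proof.
split=> [|u v /forallP hu /forallP hv]; apply/forallP => i; rewrite !mxE //.
by rewrite rpredB.
Qed.

HB.instance Definition _ (R : realType) (n : nat) :=
  GRing.isZmodClosed.Build 'rV[R]_n (@integer_points R n)
    (@integer_points_zmod_closed R n).

Definition int_lattice (R : realType) (n : nat) : zmodClosed 'rV[R]_n :=
  GRing.ZmodClosed.clone _ (@integer_points R n) _.

(* R^n / Z^n as a group, with the quotient topology and the Borel
   sigma-algebra. *)
Definition torus (R : realType) (n : nat) : Type :=
  quotient_topology (Quotient.quot (int_lattice R n)).

HB.instance Definition _ (R : realType) (n : nat) :=
  Topological.copy (torus R n)
    (quotient_topology (Quotient.quot (int_lattice R n))).
HB.instance Definition _ (R : realType) (n : nat) :=
  Pointed.copy (torus R n)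
    (quotient_topology (Quotient.quot (int_lattice R n))).
HB.instance Definition _ (R : realType) (n : nat) :=
  Quotient.copy (torus R n)
    (quotient_topology (Quotient.quot (int_lattice R n))).
HB.instance Definition _ (R : realType) (n : nat) :=
  GRing.isZmodule.Build (torus R n)
    (@Quotient.addqA _ (int_lattice R n)) (@Quotient.addqC _ (int_lattice R n))
    (@Quotient.add0q _ (int_lattice R n)) (@Quotient.addNq _ (int_lattice R n)).
HB.instance Definition _ (R : realType) (n : nat) :=
  Measurable.copy (torus R n) (g_sigma_algebraType (@open (torus R n))).

Definition torus_pi (R : realType) (n : nat) (v : 'rV[R]_n) : torus R n :=
  \pi_(torus R n)%qT v.

(* The function on the torus induced by a Z^n-periodic function g on R^n. *)
Definition torus_fun (R : realType) (n : nat) (A : Type) (g : 'rV[R]_n -> A) :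
    torus R n -> A :=
  fun z => g (repr z).

Lemma torus_funE (R : realType) (n : nat) (A : Type) (g : 'rV[R]_n -> A) :
  (forall (v : 'rV[R]_n) (k : 'rV[int]_n), g (v + int_vec R k) = g v) ->
  forall v, torus_fun g (torus_pi v) = g v.
Proof.
move=> gP v; rewrite /torus_fun /torus_pi.
set w := repr _.
have : (w == v %[mod Quotient.quot (int_lattice R n)])%qT.
  by apply/eqP; rewrite reprK.
rewrite -Quotient.idealrBE => /forallP wv.
suff -> : w = v + int_vec R (map_mx Num.floor (w - v)) by rewrite gP.
apply/rowP => i; rewrite !mxE.
by move: (wv i); rewrite !mxE intrEfloor => /eqP ->; rewrite addrC subrK.
Qed.

Lemma torus_pi_is_zmod_morphism (R : realType) (n : nat) :
  zmod_morphism (@torus_pi R n).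
Proof. exact: (@pi_is_zmod_morphism _ _ _ (Quotient.quot (int_lattice R n))). Qed.

Definition zak_modulus (R : realType) (d : nat) (f : 'rV[R]_d -> R[i]) :
    torus R (d + d) -> R :=
  torus_fun (fun v => cmod (zak f (lsubmx v) (rsubmx v))).

Definition trig_poly (R : realType) (d m : nat) (x y : 'I_m -> 'rV[int]_d)
    (c : 'I_m -> R[i]) : torus R (d + d) -> R[i] :=
  torus_fun (fun v => \sum_(k < m) c k *
    expi (- dot (int_vec R (y k)) (lsubmx v)) *
    expi (- dot (rsubmx v) (int_vec R (x k)))).

Definition rational_vec (R : realType) (n : nat) (v : 'rV[R]_n) : Prop :=
  forall i, exists q : rat, v 0 i = ratr q.

Definition full_rank_lattice (R : realType) (n : nat) (L : set 'rV[R]_n) : Prop :=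
  exists2 A : 'M[R]_n, A \in unitmx &
    L = [set int_vec R k *m A | k in [set: 'rV[int]_n]].

Definition orbit_closure (R : realType) (n : nat) (g : torus R n) :
    set (torus R n) :=
  closure [set g *~ k | k in [set: int]].

(* The normalized Haar measure of a closed subgroup H, as a Borel probability
   measure on the torus carried by H. *)
Definition normalized_haar (R : realType) (n : nat) (H : set (torus R n))
    (mH : probability (torus R n) R) : Prop :=
  mH H = 1%E /\
  forall (h : torus R n) (A : set (torus R n)), H h -> measurable A ->
    mH ((fun z => z + h) @^-1` A) = mH A.

Definition invariant_under (R : realType) (n : nat) (H S : set (torus R n)) : Prop :=
  forall z h, S z -> H h -> S (z + h).

(* lne is the extended logarithm, with lne 0 = -oo, so that integrability of
   the integrand of Theta carries content. *)
Definition log_modulus (R : realType) (n : nat) (p : torus R n -> R[i])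
    (z : torus R n) : \bar R :=
  lne (cmod (p z))%:E.

Definition Theta (R : realType) (n : nat) (p : torus R n -> R[i])
    (H : set (torus R n)) (mH : probability (torus R n) R) (z : torus R n) :
    \bar R :=
  (\int[mH]_(h in H) log_modulus p (z + h)%R)%E.

(* Main.v *)
Require Import Defs.
From HB Require Import structures.
From mathcomp Require Import all_boot all_order all_algebra.
From mathcomp Require Import generic_quotient ring_quotient finmap complex.
From mathcomp Require Import all_classical all_reals all_analysis.
From mathcomp.analysis.showcase Require summability.
From mathcomp Require Import ring lra zify.

(** Let [Z] be the Zak transform of [f], let [F] be its modulus and [e] the
    character [expi]. Time-frequency shifts by integers act on [Z] as
    multiplication by characters, so the linear relation becomes a cocycle identity,
    [Z (z + (- alpha, beta)) = e (dot beta t) * p z * Z z] with [z = (t, w)]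
    ([zak_relation]), and on the torus [F (z + gamma) = |p z| * F z]
    ([zak_modulus_step]). The theorem describes this multiplicative cocycle over the
    rotation by [gamma].

    The Zak series of a Schwartz function converges locally uniformly, so [Z] is
    continuous ([ccontinuous_zakv]); averaging over frequencies recovers [f], so
    [F] is not identically zero ([zak_inj]). The cocycle identity carries zeros of
    [F] forward along orbits. In a compact group forward multiples of [gamma] come
    back close to [- gamma] ([orbit_closure_sub]), so both the zero set of [F] and
    its complement [S] are unions of cosets of [H].

    The dense case. The quasi-periodicity of [Z] forces a change of winding number
    across the unit square of one time-frequency plane, so [Z] has a zero
    ([quasiperiodic_zero]). If [H] were the whole torus, this zero would spread
    everywhere.

    The finite case. If [r] steps of the rotation return to the start, iterating the
    cocycle identity expresses the product of [r] translates of [p] as a character,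
    wherever [Z] does not vanish. A factor of a Laurent monomial is a monomial, so
    [p] is a single character, and comparison of frequencies shows that its
    frequency is [(beta, alpha)] ([frequency_of_trig_product]). But the frequencies
    of [p] are integral and [(alpha, beta)] is not. For this configuration of points
    the argument takes the place of Linnell's theorem: a finite orbit is
    contradictory, so the assertions about it hold vacuously.

    The remaining case. For [z] in [S] the coset [z + H] is a compact subset of [S],
    so [ln F] is bounded on it. There [ln |p (z + h)|] is the difference of
    [ln F] at [z + h + gamma] and at [z + h]: it is bounded, it has mean zero by
    invariance of the measure ([orbit_coboundary_mean]), and its sums along the
    orbit telescope to bounded quantities, so that the growth rate is zero
    ([log_growth_cvg0]). *)

Set Implicit Arguments.
Unset Strict Implicit.
Unset Printing Implicit Defensive.

Import Order.TTheory GRing.Theory Num.Theory.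
Import numFieldNormedType.Exports.

Local Open Scope classical_set_scope.
Local Open Scope ring_scope.
Local Open Scope complex_scope.

Existing Instance summability.totally_filter.

Notation psum := summability.partial_sum.
Notation totally := summability.totally.
Notation cRe := complex.Re.
Notation cIm := complex.Im.

(** * Complex numbers and the circle *)

Section ComplexModulus.
Variable R : realType.
Implicit Types (z w : R[i]) (s : R).

Lemma cmodE z : `|z| = (cmod z)%:C. Proof. by case: z. Qed.
Lemma cReD z w : cRe (z + w) = cRe z + cRe w. Proof. by case: z w => [a b] [a' b']. Qed.
Lemma cImD z w : cIm (z + w) = cIm z + cIm w. Proof. by case: z w => [a b] [a' b']. Qed.
Lemma cReM z w : cRe (z * w) = cRe z * cRe w - cIm z * cIm w.
Proof. by case: z w => [a b] [a' b']. Qed.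
Lemma cImM z w : cIm (z * w) = cRe z * cIm w + cIm z * cRe w.
Proof. by case: z w => [a b] [a' b']. Qed.
Lemma cRe_sum (I : Type) (r : seq I) (P : pred I) (F : I -> R[i]) :
  cRe (\sum_(i <- r | P i) F i) = \sum_(i <- r | P i) cRe (F i).
Proof. by elim/big_rec2: _ => // i a b _ <-; rewrite cReD. Qed.
Lemma cIm_sum (I : Type) (r : seq I) (P : pred I) (F : I -> R[i]) :
  cIm (\sum_(i <- r | P i) F i) = \sum_(i <- r | P i) cIm (F i).
Proof. by elim/big_rec2: _ => // i a b _ <-; rewrite cImD. Qed.
Lemma complex_eq z w : cRe z = cRe w -> cIm z = cIm w -> z = w.
Proof. by case: z w => [a b] [a' b'] /= -> ->. Qed.

Lemma cmodM z w : cmod (z * w) = cmod z * cmod w.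
Proof. exact: ComplexField.Normc.normcM. Qed.
Lemma cmod0 : cmod (0 : R[i]) = 0. Proof. exact: ComplexField.Normc.normc0. Qed.
Lemma cmod_ge0 z : 0 <= cmod z. Proof. by case: z => a b; exact: sqrtr_ge0. Qed.
Lemma cmod_eq0 z : (cmod z == 0) = (z == 0).
Proof.
by apply/eqP/eqP => [/ComplexField.Normc.eq0_normc//|->]; exact: cmod0.
Qed.
Lemma cmodD z w : cmod (z + w) <= cmod z + cmod w.
Proof. exact: le_normcD. Qed.
Lemma cmod_sum (I : Type) (r : seq I) (P : pred I) (F : I -> R[i]) :
  cmod (\sum_(i <- r | P i) F i) <= \sum_(i <- r | P i) cmod (F i).
Proof.
elim/big_ind2 : _ => // [|x1 x2 y1 y2 h1 h2]; first by rewrite cmod0.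
exact: (le_trans (cmodD _ _) (lerD h1 h2)).
Qed.
Lemma normr_cRe z : `|cRe z| <= cmod z.
Proof. by case: z => a b /=; rewrite -[ `|a| ]sqrtr_sqr ler_wsqrtr// lerDl sqr_ge0. Qed.
Lemma normr_cIm z : `|cIm z| <= cmod z.
Proof. by case: z => a b /=; rewrite -[ `|b| ]sqrtr_sqr ler_wsqrtr// lerDr sqr_ge0. Qed.
Lemma cmod_le z : cmod z <= `|cRe z| + `|cIm z|.
Proof.
case: z => a b /=; rewrite -[leRHS]ger0_norm ?addr_ge0// -sqrtr_sqr ler_wsqrtr//.
by rewrite sqrrD !real_normK ?num_real// -addrA lerD2l lerDr mulrn_wge0// mulr_ge0.
Qed.

Lemma expiD s1 s2 : expi (s1 + s2) = expi s1 * expi s2.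
Proof.
apply: complex_eq; rewrite ?cReM ?cImM /= mulrDr ?cosD ?sinD//.
by rewrite addrC.
Qed.
Lemma expi0 : expi (0 : R) = 1.
Proof. by apply: complex_eq; rewrite /= mulr0 ?cos0 ?sin0. Qed.
Lemma cmod_expi s : cmod (expi s) = 1.
Proof. by rewrite /cmod /= cos2Dsin2 sqrtr1. Qed.
Lemma expi_neq0 s : expi s != 0.
Proof. by rewrite -cmod_eq0 cmod_expi oner_eq0. Qed.
Lemma expiNr s : expi (- s) * expi s = 1.
Proof. by rewrite -expiD addNr expi0. Qed.
Lemma expi_sum (I : Type) (r : seq I) (P : pred I) (F : I -> R) :
  expi (\sum_(i <- r | P i) F i) = \prod_(i <- r | P i) expi (F i).
Proof. exact: (big_morph _ expiD expi0). Qed.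
Lemma expiMn s n : expi (s *+ n) = expi s ^+ n.
Proof.
elim: n => [|n IH]; first by rewrite mulr0n expi0.
by rewrite mulrS expiD IH exprS.
Qed.
Lemma expi1 : expi (1 : R) = 1.
Proof. by apply: complex_eq; rewrite /= mulr1 mulr_natl ?cos2pi ?sin2pi. Qed.
Lemma expi_int (k : int) : expi (k%:~R : R) = 1.
Proof.
case: k => n; first by rewrite -pmulrn expiMn expi1 expr1n.
apply: (mulfI (expi_neq0 n.+1%:R)); rewrite -expiD NegzE mulrNz -pmulrn subrr expi0.
by rewrite expiMn expi1 expr1n mulr1.
Qed.
Lemma expi_half : expi (2^-1 : R) = -1.
Proof. by apply: complex_eq; rewrite /= mulrAC divff// mul1r ?cospi ?sinpi ?oppr0. Qed.
Lemma expi_neq1 s : 0 < `|s| < 1 -> expi s != 1.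
Proof.
suff pos (r : R) : 0 < r < 1 -> expi r != 1.
  have [s0|s0] := leP 0 s; first by rewrite ger0_norm//; exact: pos.
  rewrite ltr0_norm// => /pos; apply: contra => /eqP e1.
  by rewrite -[expi (- s)]mulr1 -[X in _ * X]e1 expiNr.
move=> /andP[r0 r1]; apply/eqP => /(congr1 (@complex.Re R)) /=.
have -> : 2 * pi * r = (pi * r) *+ 2 by rewrite -mulrA mulr_natl.
rewrite cos_mulr2n => /eqP.
have sp : 0 < sin (pi * r).
  by apply: sin_gt0_pi; rewrite mulr_gt0 ?pi_gt0//= gtr_pMr ?pi_gt0.
rewrite cos2sin2 => /eqP h.
have : sin (pi * r) ^+ 2 > 0 by rewrite exprn_gt0.
lra.
Qed.
Lemma expi_inj s1 s2 : `|s1 - s2| < 1 -> expi s1 = expi s2 -> s1 = s2.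
Proof.
move=> lt1 e12; apply/eqP; rewrite -subr_eq0 -normr_eq0; apply/negPn/negP => n0.
have /negP ne1 : expi (s1 - s2) != 1.
  by apply: expi_neq1; rewrite lt1 lt_def n0 normr_ge0.
by apply: ne1; rewrite expiD e12 mulrC expiNr.
Qed.

End ComplexModulus.

(** * Unconditional sums *)

Section UnconditionalSums.
Variables (R : realType) (I : choiceType).
Implicit Types (u g : I -> R^o) (J : {fset I}).
Local Open Scope fset_scope.
Local Open Scope ring_scope.

Lemma psumE u J : psum u J = \sum_(i <- J) u i.
Proof. by rewrite big_seq_fsetE. Qed.

Lemma near_totally (J0 : {fset I}) (P : {fset I} -> Prop) :
  (forall J, J0 `<=` J -> P J) -> \forall J \near totally, P J.
Proof. by move=> h; exists J0. Qed.

Lemma psumB u J0 J : J0 `<=` J ->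
  psum u J - psum u J0 = \sum_(i <- J `\` J0) u i.
Proof.
move=> s; rewrite !psumE (big_fsetID _ (mem J0) J) /=.
have -> : \sum_(i <- [fset x in J | x \in J0]) u i = \sum_(i <- J0) u i.
  by apply: eq_fbigl => i; rewrite !inE /= -in_fsetI (fsetIidPr s).
rewrite addrAC subrr add0r; apply: eq_fbigl => i; rewrite !inE /=; exact: andbC.
Qed.

(** The partial sums of a nonnegative family increase, so a finite set whose
    partial sum is within [e] of the supremum leaves only a tail of size [e]. This
    is the one quantitative fact from which all the convergence below is drawn. *)
Lemma bounded_psum_tail g (B : R) : (forall i, 0 <= g i) ->
  (forall J, psum g J <= B) -> forall e : R, 0 < e ->
  exists J0, forall J, J0 `<=` J -> psum g J - psum g J0 <= e.
Proof.
move=> g0 gB e e0; pose E := [set psum g J | J in [set: {fset I}]]%classic.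
have supE : has_sup E.
  split; first by exists (psum g fset0), fset0.
  by exists B => _ [J _ <-].
have [_ [J0 _ <-] h] := sup_adherent e0 supE; exists J0 => J _.
have : psum g J <= sup E by apply: ub_le_sup; [exact: supE.2|exists J].
by move: h; lra.
Qed.

Lemma psum_dominated_le u g J0 J : (forall i, `|u i| <= g i) -> J0 `<=` J ->
  `|psum u J - psum u J0| <= psum g J - psum g J0.
Proof.
move=> ug s; rewrite !psumB//; apply: (le_trans (ler_norm_sum _ _ _)).
exact: ler_sum.
Qed.

(** The tails of the dominating family make the net of partial sums Cauchy. *)
Lemma dominated_sum_cvg u g (B : R) : (forall i, `|u i| <= g i) ->
  (forall J, psum g J <= B) ->
  psum u J @[J --> totally] --> (summability.sum u : R^o).
Proof.
move=> ug gB; have g0 i : 0 <= g i := le_trans (normr_ge0 _) (ug i).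
apply/cauchy_cvgP/cauchy_exP => e e0.
have e20 : 0 < e / 2 by rewrite divr_gt0.
have [J0 h] := bounded_psum_tail g0 gB e20.
exists (psum u J0); apply: (@near_totally J0) => J s.
rewrite /= -ball_normE /= distrC.
apply: (le_lt_trans (psum_dominated_le ug s)); apply: (le_lt_trans (h _ s)).
by rewrite ltr_pdivrMr// mulr_natr mulr2n ltrDl.
Qed.

Lemma dominated_sum_tail u g (s e : R) J0 : (forall i, `|u i| <= g i) ->
  psum u J @[J --> totally] --> (s : R^o) ->
  (forall J, J0 `<=` J -> psum g J - psum g J0 <= e) ->
  `|s - psum u J0| <= e.
Proof.
move=> ug cu h.
have c1 : `|psum u J - psum u J0| @[J --> totally] --> `|(s : R^o) - psum u J0|.
  by apply: cvg_norm; apply: cvgB => //; exact: cvg_cst.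
apply: (cvgr_to_le c1); apply: (@near_totally J0) => J sJ.
exact: (le_trans (psum_dominated_le ug sJ) (h _ sJ)).
Qed.

(** The Weierstrass M-test: a finite part of the sum is continuous, and the
    remainder is uniformly small near [x] because the domination holds there. *)
Lemma dominated_sum_continuous (T : topologicalType) (u : I -> T -> R) g (B : R)
    (x : T) :
  (forall i, {for x, continuous (u i)}) ->
  (\forall y \near x, forall i, `|u i y| <= g i) ->
  (forall J, psum g J <= B) ->
  {for x, continuous (fun y => summability.sum (fun i => u i y : R^o) : R)}.
Proof.
move=> uc ug gB; have g0 i : 0 <= g i.
  by have /(_ i) := nbhs_singleton ug; apply: le_trans.
apply/cvgrPdist_le => e e0; have e30 : 0 < e / 3 by rewrite divr_gt0.
have [J0 h] := bounded_psum_tail g0 gB e30.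
have c1 : {for x, continuous (fun y => \sum_(i <- J0) u i y)}.
  by apply: cvg_big => [|i _]; [exact: add_continuous|exact: uc].
have /cvgrPdist_le/(_ _ e30) c2 := c1.
near=> y.
have hy : forall i, `|u i y| <= g i by near: y.
have hx : forall i, `|u i x| <= g i := nbhs_singleton ug.
have := dominated_sum_tail hx (dominated_sum_cvg hx gB) h.
have := dominated_sum_tail hy (dominated_sum_cvg hy gB) h.
have : `|\sum_(i <- J0) u i x - \sum_(i <- J0) u i y| <= e / 3 by near: y.
rewrite !psumE; set a := summability.sum _; set b := summability.sum _.
rewrite !ler_norml; lra.
Unshelve. all: by end_near. Qed.
End UnconditionalSums.

Section ComplexSums.
Variables (R : realType) (I : choiceType).
Implicit Types (u v : I -> R[i]) (g : I -> R^o) (s t : R[i]) (J : {fset I}).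
Local Open Scope fset_scope.
Local Open Scope ring_scope.

(** A relational form of [csum]: it can be transported through linear
    combinations and reindexings without any summability side condition, and
    [has_csum_uniq] turns two computations of the same sum into an equality. *)
Definition has_csum u s : Prop :=
  psum (fun k => cRe (u k) : R^o) J @[J --> totally] --> (cRe s : R^o) /\
  psum (fun k => cIm (u k) : R^o) J @[J --> totally] --> (cIm s : R^o).

Lemma has_csum_uniq u s t : has_csum u s -> has_csum u t -> s = t.
Proof.
move=> [rs is_] [rt it]; apply: complex_eq.
  exact: (cvg_unique _ rs rt).
exact: (cvg_unique _ is_ it).
Qed.

Lemma eq_has_csum u v s : u =1 v -> has_csum u s -> has_csum v s.
Proof. by move=> /funext ->. Qed.

Lemma has_csum0 : has_csum (fun=> 0) 0.
Proof.
by split; under eq_fun do rewrite psumE big1//; exact: cvg_cst.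
Qed.

Lemma has_csumD u v s t : has_csum u s -> has_csum v t ->
  has_csum (fun k => u k + v k) (s + t).
Proof.
move=> [rs is_] [rt it]; split.
  rewrite cReD; under eq_fun do rewrite psumE (eq_bigr _ (fun i _ => cReD _ _)).
  by under eq_fun do rewrite big_split -!psumE; apply: cvgD.
rewrite cImD; under eq_fun do rewrite psumE (eq_bigr _ (fun i _ => cImD _ _)).
by under eq_fun do rewrite big_split -!psumE; apply: cvgD.
Qed.

Lemma has_csumM (a : R[i]) u s : has_csum u s -> has_csum (fun k => a * u k) (a * s).
Proof.
move=> [rs is_]; split.
  rewrite cReM; under eq_fun do rewrite psumE (eq_bigr _ (fun i _ => cReM _ _)).
  under eq_fun do rewrite big_split sumrN -!mulr_sumr -!psumE.
  by apply: cvgB; apply: cvgM => //; exact: cvg_cst.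
rewrite cImM; under eq_fun do rewrite psumE (eq_bigr _ (fun i _ => cImM _ _)).
under eq_fun do rewrite big_split -!mulr_sumr -!psumE.
by apply: cvgD; apply: cvgM => //; exact: cvg_cst.
Qed.

Lemma has_csum_sum (m : nat) (u : 'I_m -> I -> R[i]) (s : 'I_m -> R[i]) :
  (forall j, has_csum (u j) (s j)) ->
  has_csum (fun k => \sum_(j < m) u j k) (\sum_(j < m) s j).
Proof.
elim: m u s => [|m IH] u s h.
  by rewrite big_ord0; apply: eq_has_csum has_csum0 => k; rewrite big_ord0.
rewrite big_ord_recl; apply: (@eq_has_csum (fun k => u ord0 k +
  \sum_(j < m) u (lift ord0 j) k)) => [k|]; first by rewrite big_ord_recl.
by apply: has_csumD => //; apply: IH => j; exact: h.
Qed.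

(** A bijection of the index set permutes the finite subsets, and maps the
    filter of large finite sets to itself. *)
Lemma has_csum_reindex (f f' : I -> I) u s : cancel f f' -> cancel f' f ->
  has_csum u s -> has_csum (u \o f) s.
Proof.
move=> fK f'K.
have ft : (fun J : {fset I} => [fset f x | x in J]) J @[J --> totally] --> totally.
  move=> P [J0 _ h]; exists [fset f' x | x in (J0 : {fset I})] => // J /= sJ; apply: h => /=.
  apply/fsubsetP => x xJ0; apply/imfsetP; exists (f' x) => //=.
  by apply: (fsubsetP sJ); apply/imfsetP; exists x.
have fE (w : I -> R^o) J : psum (w \o f) J = psum w [fset f x | x in J].
  by rewrite !psumE big_imfset//= => x y _ _ /(can_inj fK).
have key (w : I -> R^o) (l : R^o) : psum w J @[J --> totally] --> l ->
    psum (w \o f) J @[J --> totally] --> l.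
  move=> c; rewrite (_ : psum (w \o f) = psum w \o (fun J : {fset I} => [fset f x | x in J])).
    exact: cvg_comp ft c.
  by apply/funext => J; exact: fE.
by move=> [/key ? /key].
Qed.

Lemma has_csum_tail u s g (e : R) J0 : (forall i, cmod (u i) <= g i) ->
  has_csum u s ->
  (forall J, J0 `<=` J -> psum g J - psum g J0 <= e) ->
  cmod (s - \sum_(k <- J0) u k) <= e *+ 2.
Proof.
move=> ug [rs is_] h; apply: (le_trans (cmod_le _)); rewrite mulr2n.
rewrite cReD cImD.
have -> z : cRe (- z) = - cRe z :> R by case: z.
have -> z : cIm (- z) = - cIm z :> R by case: z.
rewrite cRe_sum cIm_sum -!psumE; apply: lerD.
  by apply: dominated_sum_tail rs h => i; apply: le_trans (ug i); exact: normr_cRe.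
by apply: dominated_sum_tail is_ h => i; apply: le_trans (ug i); exact: normr_cIm.
Qed.

End ComplexSums.

Lemma csum_dominated (R : realType) (d : nat) (u : 'rV[int]_d -> R[i])
    (g : 'rV[int]_d -> R^o) (B : R) :
  (forall i, cmod (u i) <= g i) -> (forall J, psum g J <= B) -> has_csum u (csum u).
Proof.
move=> ug gB; split => /=.
  by apply: dominated_sum_cvg gB => i; apply: le_trans (ug i); exact: normr_cRe.
by apply: dominated_sum_cvg gB => i; apply: le_trans (ug i); exact: normr_cIm.
Qed.

(** * Schwartz decay along the integer lattice *)

Section LatticeWeight.
Variables (R : realType) (d : nat).
Implicit Types (k : 'rV[int]_d) (t x : 'rV[R]_d).
Local Open Scope fset_scope.
Local Open Scope ring_scope.

Definition bracket_weight (s : R) : R := (1 + s ^+ 2)^-1.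

Definition lattice_weight k : R := \prod_(i < d) bracket_weight (k 0 i)%:~R.

Lemma bracket_weight_gt0 s : 0 < bracket_weight s.
Proof. by rewrite invr_gt0; have := sqr_ge0 s; lra. Qed.

Lemma lattice_weight_ge0 k : 0 <= lattice_weight k.
Proof. by apply: prodr_ge0 => i _; exact: ltW (bracket_weight_gt0 _). Qed.

(** The slack [4 / (n + 1)] is what makes the bound go through by induction:
    the two new terms are at most the telescoping difference. *)
Lemma bracket_weight_symmetric_sum n :
  \sum_(j < n.*2.+1) bracket_weight (j%:R - n%:R) <= 5 - 4 / n.+1%:R.
Proof.
elim: n => [|n IH].
  by rewrite big_ord1 subrr /bracket_weight expr0n addr0 invr1; lra.
rewrite doubleS big_ord_recl big_ord_recr /=.
have -> : \sum_(j < n.*2.+1) bracket_weight ((bump 0 j)%:R - n.+1%:R)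
        = \sum_(j < n.*2.+1) bracket_weight (j%:R - n%:R).
  apply: eq_bigr => j _; congr bracket_weight; rewrite /bump leq0n add1n -!natr1.
  by ring.
have -> : bracket_weight (0%:R - n.+1%:R) = bracket_weight n.+1%:R.
  by rewrite /bracket_weight sub0r sqrrN.
have -> : (bump 0 n.*2.+1)%:R - n.+1%:R = n.+1%:R :> R.
  by rewrite /bump leq0n add1n -!natr1 -addnn natrD; ring.
suff h : bracket_weight n.+1%:R *+ 2 <= 4 / n.+1%:R - 4 / n.+2%:R.
  move: IH h; rewrite mulr2n; move: (4 / n.+1%:R) (4 / n.+2%:R).
  by move: (\sum_(j < _) _) (bracket_weight _) => ? ? ? ?; lra.
rewrite /bracket_weight -(natr1 n.+1); set a : R := n.+1%:R.
have a0 : 0 < a by rewrite ltr0n.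
have -> : 4 / a - 4 / (a + 1) = 4 / (a * (a + 1)).
  by field; rewrite gt_eqF//= gt_eqF//; lra.
rewrite -[leLHS]mulr_natl ler_pdivlMr; last by nra.
by rewrite mulrAC ler_pdivrMr; nra.
Qed.

(** Every finite set of lattice points lies in a cube, over which the sum of
    products is a product of one-dimensional sums. *)
Lemma lattice_weight_bounded : exists B, forall J, psum (lattice_weight : _ -> R^o) J <= B.
Proof.
exists (5 ^+ d) => J; rewrite psumE.
pose n := \max_(k <- J) \max_(i < d) absz (k 0%R i).
have nP k (i : 'I_d) : k \in J -> (absz (k 0%R i) <= n)%N.
  move=> kJ; apply: (@leq_trans (\max_(i < d) absz (k 0%R i))).
    by rewrite (bigD1 i)//= leq_maxl.
  exact: (@leq_bigmax_seq _ _ xpredT (fun k : 'rV[int]_d => \max_(i < d) absz (k 0%R i))%N).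
pose vec (phi : {ffun 'I_d -> 'I_n.*2.+1}) : 'rV[int]_d := \row_i ((phi i)%:Z - n%:Z).
have vecI : injective vec.
  move=> p q /rowP e; apply/ffunP => i; apply/val_inj.
  by have := e i; rewrite !mxE => /addIr[].
have sub : J `<=` [fset vec phi | phi in {: {ffun 'I_d -> 'I_n.*2.+1}}].
  apply/fsubsetP => k kJ; apply/imfsetP.
  (* The coordinates range over [-n, n], shifted to start at 0. *)
  exists [ffun i => inord (absz (k 0%R i + n%:Z)%R)]; first by rewrite /= inE.
  apply/rowP => i; rewrite !mxE ffunE; have := nP k i kJ.
  by move: (k 0%R i) => z zn; rewrite inordK; lia.
have le1 : \sum_(k <- J) lattice_weight k <= \sum_(k <- [fset vec phi | phi in
    {: {ffun 'I_d -> 'I_n.*2.+1}}]) lattice_weight k.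
  rewrite -!psumE -subr_ge0 psumB//; apply: sumr_ge0 => k _.
  exact: lattice_weight_ge0.
apply: (le_trans le1).
rewrite big_imfset/=; last by move=> ? ? _ _; exact: vecI.
rewrite big_enum/=.
rewrite (eq_bigr (fun phi : {ffun 'I_d -> 'I_n.*2.+1} =>
    \prod_(i < d) bracket_weight ((phi i)%:R - n%:R))); last first.
  by move=> phi _; apply: eq_bigr => i _; rewrite mxE intrB.
rewrite -(bigA_distr_bigA (fun (_ : 'I_d) (j : 'I_n.*2.+1) => bracket_weight (j%:R - n%:R))).
rewrite prodr_const card_ord lerXn2r ?nnegrE//.
  by apply: sumr_ge0 => j _; exact: ltW (bracket_weight_gt0 _).
apply: (le_trans (bracket_weight_symmetric_sum n)).
by rewrite gerBl divr_ge0.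
Qed.

End LatticeWeight.

Section SchwartzDecay.
Variables (R : realType) (d : nat).
Implicit Types (k : 'rV[int]_d) (t x : 'rV[R]_d) (f : 'rV[R]_d -> R[i]).

(** Expanding the product of the factors [1 + x_i ^ 2] over the subsets of the
    coordinates gives a sum of monomials, each controlled by one Schwartz seminorm
    of order zero. *)
Lemma real_schwartz_decay (g : 'rV[R]_d -> R) : real_schwartz g ->
  exists C, forall x, `|g x| <= C * \prod_(i < d) bracket_weight (x 0 i).
Proof.
move=> [_ dec].
have /choice[C CP] (A : {set 'I_d}) : exists c, forall x : 'rV[R]_d,
    `|(\prod_(i < d) x 0 i ^+ (if i \in A then 0 else 2)) * g x| <= c.
  exact: (dec (fun i => if i \in A then 0 else 2)%N [::]).
exists (\sum_A C A) => x.
have weight_prod : \prod_(i < d) bracket_weight (x 0 i) = (\prod_(i < d) (1 + x 0 i ^+ 2))^-1.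
  by rewrite prodfV.
have w0 : 0 < \prod_(i < d) (1 + x 0 i ^+ 2).
  by apply: prodr_gt0 => i _; have := sqr_ge0 (x 0 i); lra.
rewrite weight_prod ler_pdivlMr// bigA_distr mulr_sumr; apply: ler_sum => A _.
apply: le_trans (CP A x); rewrite mulrC normrM ler_wpM2r//.
apply: le_trans (ler_norm _); rewrite le_eqVlt; apply/orP; left; apply/eqP.
by apply: eq_bigr => i _; case: ifP; rewrite ?expr0.
Qed.

Lemma schwartz_decay f : schwartz f ->
  exists C, forall x, cmod (f x) <= C * \prod_(i < d) bracket_weight (x 0 i).
Proof.
move=> [/real_schwartz_decay[C1 h1] /real_schwartz_decay[C2 h2]].
exists (C1 + C2) => x; rewrite mulrDl.
exact: le_trans (cmod_le _) (lerD (h1 x) (h2 x)).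
Qed.

(** Peetre's inequality: moving the centre of the weight costs only a factor
    that depends on the displacement, so that one summable weight dominates the
    Zak series for all base points in a bounded region. *)
Lemma peetre_inequality (s a : R) : bracket_weight (s + a) <= 2 * (1 + s ^+ 2) * bracket_weight a.
Proof.
rewrite /bracket_weight ler_pdivlMr; last by have := sqr_ge0 a; lra.
rewrite mulrC ler_pdivrMr; last by have := sqr_ge0 (s + a); lra.
have := sqr_ge0 (s + (s + a)); have := sqr_ge0 (s * (s + a)).
by have := sqr_ge0 s; have := sqr_ge0 (s + a); nra.
Qed.

Definition shift_cost t : R := \prod_(i < d) (2 * (1 + t 0 i ^+ 2)).

Lemma schwartz_decay_lattice f : schwartz f -> exists2 C, 0 <= C &
  forall t k, cmod (f (t + int_vec R k)) <= C * shift_cost t * lattice_weight R k.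
Proof.
move=> /schwartz_decay[C h]; exists `|C| => // t k.
apply: (le_trans (h _)); apply: (@le_trans _ _ (`|C| *
    \prod_(i < d) bracket_weight ((t + int_vec R k) 0 i))).
  rewrite ler_wpM2r ?ler_norm//; apply: prodr_ge0 => i _; exact: ltW (bracket_weight_gt0 _).
rewrite -mulrA ler_wpM2l// -big_split /=; apply: ler_prod => i _.
by rewrite ltW ?bracket_weight_gt0//= !mxE peetre_inequality.
Qed.

Lemma continuous_shift_cost : continuous shift_cost.
Proof.
apply: continuous_big => [|i _ t]; first exact: mul_continuous.
apply: (@cvgM R _ (nbhs t) _ (fun=> 2)); first exact: cvg_cst.
apply: (@cvgD _ R^o _ (nbhs t) _ (fun=> 1)); first exact: cvg_cst.
under eq_fun do rewrite expr2; rewrite expr2; apply: cvgM; exact: coord_continuous.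
Qed.

End SchwartzDecay.

(** * Complex continuity, inner products and the Zak transform *)

Section ComplexContinuity.
Variables (R : realType) (T : topologicalType).
Implicit Types (g h : T -> R[i]).

Definition ccontinuous g :=
  continuous (fun x => cRe (g x)) /\ continuous (fun x => cIm (g x)).

Lemma ccontinuousM g h : ccontinuous g -> ccontinuous h ->
  ccontinuous (fun x => g x * h x).
Proof.
move=> [rg ig] [rh ih]; split.
  under eq_fun do rewrite cReM.
  by move=> x; apply: cvgB; apply: cvgM; [exact: rg|exact: rh|exact: ig|exact: ih].
under eq_fun do rewrite cImM.
by move=> x; apply: cvgD; apply: cvgM; [exact: rg|exact: ih|exact: ig|exact: rh].
Qed.

Lemma ccontinuous_prod (I : Type) (r : seq I) (F : I -> T -> R[i]) :
  (forall i, ccontinuous (F i)) -> ccontinuous (fun x => \prod_(i <- r) F i x).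
Proof.
move=> h; elim: r => [|i r IH].
  by split; under eq_fun do rewrite big_nil; move=> x; exact: cvg_cst.
by under eq_fun do rewrite big_cons; exact: ccontinuousM.
Qed.

Lemma ccontinuous_expi (s : T -> R) : continuous s -> ccontinuous (fun x => expi (s x)).
Proof.
move=> cs.
have c2 : continuous (fun x => 2 * pi * s x).
  by move=> x; apply: (@cvgM R _ (nbhs x) _ (fun=> 2 * pi)); [exact: cvg_cst|exact: cs].
split=> x /=.
  exact: continuous_comp (c2 x) (@continuous_cos _ _).
exact: continuous_comp (c2 x) (@continuous_sin _ _).
Qed.

Lemma continuous_cmod g : ccontinuous g -> continuous (fun x => cmod (g x)).
Proof.
move=> [rg ig].
have -> : (fun x => cmod (g x)) = (fun x => Num.sqrt (cRe (g x) ^+ 2 + cIm (g x) ^+ 2)).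
  by apply/funext => x; case: (g x).
move=> x; apply: continuous_comp; last exact: sqrt_continuous.
apply: cvgD; [under eq_fun do rewrite expr2|under eq_fun do rewrite expr2];
  rewrite expr2; apply: cvgM; [exact: rg|exact: rg|exact: ig|exact: ig].
Qed.

End ComplexContinuity.

Lemma ccontinuous_comp (R : realType) (T U : topologicalType) (g : U -> R[i])
    (h : T -> U) : continuous h -> ccontinuous g -> ccontinuous (g \o h).
Proof.
move=> ch [rg ig]; split=> x.
  exact: (continuous_comp (ch x) (rg (h x))).
exact: (continuous_comp (ch x) (ig (h x))).
Qed.

Section DotProduct.
Variables (R : realType).
Implicit Types (n : nat).

Lemma dotDl n (u v w : 'rV[R]_n) : dot (u + v) w = dot u w + dot v w.
Proof. by rewrite /dot -big_split; apply: eq_bigr => i _; rewrite mxE mulrDl. Qed.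
Lemma dotC n (u v : 'rV[R]_n) : dot u v = dot v u.
Proof. by apply: eq_bigr => i _; rewrite mulrC. Qed.
Lemma dotDr n (u v w : 'rV[R]_n) : dot u (v + w) = dot u v + dot u w.
Proof. by rewrite dotC dotDl !(dotC u). Qed.
Lemma dotZl n a (u v : 'rV[R]_n) : dot (a *: u) v = a * dot u v.
Proof. by rewrite /dot mulr_sumr; apply: eq_bigr => i _; rewrite mxE mulrA. Qed.
Lemma dotZr n a (u v : 'rV[R]_n) : dot u (a *: v) = a * dot u v.
Proof. by rewrite dotC dotZl dotC. Qed.
Lemma dotNl n (u v : 'rV[R]_n) : dot (- u) v = - dot u v.
Proof. by rewrite -scaleN1r dotZl mulN1r. Qed.
Lemma dotNr n (u v : 'rV[R]_n) : dot u (- v) = - dot u v.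
Proof. by rewrite dotC dotNl dotC. Qed.
Lemma dot0l n (v : 'rV[R]_n) : dot 0 v = 0.
Proof. by rewrite -(scale0r 0) dotZl mul0r. Qed.
Lemma dot_row_mx n1 n2 (u1 v1 : 'rV[R]_n1) (u2 v2 : 'rV[R]_n2) :
  dot (row_mx u1 u2) (row_mx v1 v2) = dot u1 v1 + dot u2 v2.
Proof.
rewrite /dot big_split_ord; congr (_ + _); apply: eq_bigr => i _.
  by rewrite !row_mxEl.
by rewrite !row_mxEr.
Qed.

(** The inner product of integer vectors, kept in [int] so that characters at
    integer points can be recognised as trivial. *)
Definition idot n (u v : 'rV[int]_n) : int := \sum_(i < n) u 0 i * v 0 i.

Lemma dot_int_vec n (u v : 'rV[int]_n) :
  dot (int_vec R u) (int_vec R v) = (idot u v)%:~R.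
Proof.
by rewrite /dot /idot rmorph_sum; apply: eq_bigr => i _; rewrite !mxE rmorphM.
Qed.
Lemma int_vecD n (u v : 'rV[int]_n) : int_vec R (u + v) = int_vec R u + int_vec R v.
Proof. exact: raddfD. Qed.
Lemma int_vecN n (u : 'rV[int]_n) : int_vec R (- u) = - int_vec R u.
Proof. exact: raddfN. Qed.
Lemma int_vec0 n : int_vec R (0 : 'rV[int]_n) = 0.
Proof. exact: raddf0. Qed.
Lemma continuous_dotr n (u : 'rV[R]_n) : continuous (dot u).
Proof.
apply: continuous_big => [|i _ v]; first exact: add_continuous.
apply: (@cvgM R _ (nbhs v) _ (fun=> u 0 i)); [exact: cvg_cst|exact: coord_continuous].
Qed.
End DotProduct.

Section ZakTransform.
Variables (R : realType) (d : nat) (f : 'rV[R]_d -> R[i]).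
Hypothesis hf : schwartz f.
Implicit Types (k : 'rV[int]_d) (t w : 'rV[R]_d) (v : 'rV[R]_(d + d)).

Definition zak_term t w k : R[i] := expi (- dot w (int_vec R k)) * f (t + int_vec R k).

Lemma cmod_zak_term t w k : cmod (zak_term t w k) = cmod (f (t + int_vec R k)).
Proof. by rewrite cmodM cmod_expi mul1r. Qed.

(** One summable weight dominates the Zak series at every base point, up to a
    factor that is locally bounded in [t] and does not involve [w]. *)
Lemma zak_dominated : exists2 C : R, 0 <= C & exists B : R,
  (forall t w k, cmod (zak_term t w k) <= C * shift_cost t * lattice_weight R k) /\
  forall (a : R), 0 <= a -> forall J, psum (fun k => a * lattice_weight R k : R^o) J <= a * B.
Proof.
have [C C0 h] := schwartz_decay_lattice hf; have [B hB] := lattice_weight_bounded R d.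
exists C => //; exists B; split; first by move=> t w k; rewrite cmod_zak_term.
by move=> a a0 J; rewrite psumE -mulr_sumr ler_wpM2l// -psumE.
Qed.

Lemma shift_cost_ge0 t : 0 <= shift_cost t.
Proof. by apply: prodr_ge0 => i _; have := sqr_ge0 (t 0 i); lra. Qed.

Lemma has_csum_zak t w : has_csum (zak_term t w) (zak f t w).
Proof.
have [C C0 [B [h hB]]] := zak_dominated.
apply: csum_dominated (h t w) _ => J.
by apply: hB; rewrite mulr_ge0// shift_cost_ge0.
Qed.

Lemma zak_shift_time t w k :
  zak f (t + int_vec R k) w = expi (dot w (int_vec R k)) * zak f t w.
Proof.
apply: has_csum_uniq (has_csum_zak _ _) _.
have := has_csumM (expi (dot w (int_vec R k)))
  (has_csum_reindex (addrK k) (subrK k) (has_csum_zak t w)).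
apply: eq_has_csum => m; rewrite /= /zak_term mulrA -expiD int_vecD dotDr.
congr (expi _ * f _); first by ring.
by rewrite -addrA [int_vec R k + _]addrC.
Qed.

Lemma zak_shift_freq t w k : zak f t (w + int_vec R k) = zak f t w.
Proof.
congr csum; apply/funext => m.
by rewrite dotDl opprD expiD dot_int_vec -mulrNz expi_int mulr1.
Qed.

(** The Zak transform on the phase space itself, where the shift by
    [(- alpha, beta)] is a translation. *)
Definition zakv v : R[i] := zak f (lsubmx v) (rsubmx v).

Lemma zakv_row t w : zakv (row_mx t w) = zak f t w.
Proof. by rewrite /zakv row_mxKl row_mxKr. Qed.

Lemma ccontinuous_zakv : ccontinuous zakv.
Proof.
have [rf imf] := conj (hf.1.1 [::]).1 (hf.2.1 [::]).1.
have [C C0 [B [h hB]]] := zak_dominated.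
have tc k : ccontinuous (fun v => zak_term (lsubmx v) (rsubmx v) k).
  apply: ccontinuousM.
    have cd : continuous (fun v : 'rV[R]_(d + d) => dot (rsubmx v) (int_vec R k)).
      under eq_fun do rewrite dotC.
      by move=> v; apply: continuous_comp; [exact: continuous_rsubmx|exact: continuous_dotr].
    by apply: ccontinuous_expi => v; apply: (@cvgN _ R^o _ (nbhs v)); exact: cd.
  have ct : continuous (fun v : 'rV[R]_(d + d) => lsubmx v + int_vec R k).
    by move=> v; apply: (@cvgD _ _ _ (nbhs v)); [exact: continuous_lsubmx|exact: cvg_cst].
  exact: (ccontinuous_comp ct (conj rf imf)).
have dom v0 : \forall v \near v0, forall k,
    cmod (zak_term (lsubmx v) (rsubmx v) k) <=
    C * (shift_cost (lsubmx v0) + 1) * lattice_weight R k.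
  have cs : shift_cost (lsubmx v) @[v --> v0] --> shift_cost (lsubmx v0).
    exact: continuous_comp (@continuous_lsubmx _ _ _ _ v0) (@continuous_shift_cost _ _ _).
  near=> v => k; apply: le_trans (h _ _ _) _.
  rewrite ler_wpM2r ?lattice_weight_ge0// ler_wpM2l//.
  by near: v; apply: cvgr_le cs _ _; rewrite ltrDl.
have B0 v0 : forall J,
    psum (fun k => C * (shift_cost (lsubmx v0) + 1) * lattice_weight R k : R^o) J <=
    C * (shift_cost (lsubmx v0) + 1) * B.
  by apply: hB; rewrite mulr_ge0// addr_ge0// shift_cost_ge0.
split=> v0.
  apply: (dominated_sum_continuous (fun k => (tc k).1 v0) _ (B0 v0)).
  by apply: filterS (dom v0) => v hv k; apply: le_trans (hv k); exact: normr_cRe.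
apply: (dominated_sum_continuous (fun k => (tc k).2 v0) _ (B0 v0)).
by apply: filterS (dom v0) => v hv k; apply: le_trans (hv k); exact: normr_cIm.
Unshelve. all: by end_near. Qed.

End ZakTransform.

(** * Injectivity of the Zak transform *)

(** Along [(1, B, B ^ 2, ...)] the inner product with a nonzero vector is the
    value at [B] of a nonzero polynomial; any [B] that avoids the finitely many
    roots works for a whole finite set of vectors. *)
Lemma separating_functional n (s : seq 'rV[int]_n) :
  exists v : 'rV[int]_n, forall k, k \in s -> k != 0 -> idot k v != 0.
Proof.
pose P (k : 'rV[int]_n) : {poly int} := \poly_(i < n) (if insub i is Some j then k 0 j else 0).
have P0 k : k != 0 -> P k != 0.
  apply: contra => /eqP/polyP Pk; apply/eqP/rowP => i; have := Pk i.
  by rewrite coef_poly coef0 ltn_ord valK mxE.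
pose Q := \prod_(k <- s | k != 0) P k.
have Q0 : Q != 0.
  by rewrite prodf_seq_neq0; apply/allP => k _; apply/implyP; exact: P0.
have [B QB] : exists B : nat, Q.[B%:R] != 0.
  apply/not_existsP => h; have /negP := Q0; apply.
  apply/eqP/(@roots_geq_poly_eq0 _ _ [seq (B%:R : int) | B <- iota 0 (size Q)]).
  - by apply/allP => _ /mapP[B _ ->]; apply/negPn/negP; exact: h.
  - by rewrite map_inj_uniq ?iota_uniq// => a b /eqP; rewrite eqr_nat => /eqP.
  - by rewrite size_map size_iota.
exists (\row_i B%:R ^+ i) => k ks k0.
have -> : idot k (\row_i B%:R ^+ i) = (P k).[B%:R].
  rewrite horner_poly; apply: eq_bigr => i _; by rewrite mxE valK.
apply: contra QB => /eqP e.
by rewrite horner_prod (big_rem k)//= k0 e mul0r.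
Qed.

Section ZakInjective.
Variables (R : realType) (d : nat) (f : 'rV[R]_d -> R[i]).
Hypothesis hf : schwartz f.
Implicit Types (k : 'rV[int]_d) (t w : 'rV[R]_d).
Local Open Scope fset_scope.
Local Open Scope ring_scope.

(** The mean of the character of frequency [q] over the [M]-th roots of unity. *)
Definition circle_mean (M : nat) (q : int) : R[i] :=
  M%:R^-1 * \sum_(j < M) expi (- ((j%:R / M%:R) * q%:~R)).

Lemma circle_mean0 M : (0 < M)%N -> circle_mean M 0 = 1.
Proof.
move=> M0; rewrite /circle_mean (eq_bigr (fun=> 1)) => [|j _].
  by rewrite sumr_const card_ord mulVf// pnatr_eq0 -lt0n.
by rewrite mulr0 oppr0 expi0.
Qed.

Lemma circle_mean_eq0 M q : (0 < absz q < M)%N -> circle_mean M q = 0.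
Proof.
move=> /andP[q0 qM]; have M0 : (0 < M)%N by exact: leq_ltn_trans qM.
have MR : (M%:R : R) != 0 by rewrite pnatr_eq0 -lt0n.
set z : R[i] := expi (- (q%:~R / M%:R)).
have -> : circle_mean M q = M%:R^-1 * \sum_(j < M) z ^+ j.
  congr (_ * _); apply: eq_bigr => j _; rewrite /z -expiMn; congr expi.
  by rewrite -mulr_natr; ring.
have zM : z ^+ M = 1.
  rewrite /z -expiMn -(expi_int R (- q)); congr expi.
  by rewrite -[LHS]mulr_natr mulNr divfK// mulrNz.
have z1 : z != 1.
  apply: expi_neq1; rewrite normrN normrM normfV (ger0_norm (ler0n R M)).
  have -> : `|q%:~R| = (absz q)%:R :> R by rewrite -intr_norm -abszE.
  by rewrite divr_gt0 ?ltr0n//= ltr_pdivrMr ?ltr0n// mul1r ltr_nat.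
apply/eqP; rewrite mulf_eq0; apply/orP; right.
have := subrX1 z M; rewrite zM subrr => /esym/eqP.
by rewrite mulf_eq0 subr_eq0 (negPf z1).
Qed.

Lemma cmod_circle_mean M q : cmod (circle_mean M q) <= 1.
Proof.
have [->|M0] := posnP M; first by rewrite /circle_mean big_ord0 mulr0 cmod0.
rewrite cmodM.
have -> : cmod (M%:R^-1 : R[i]) = M%:R^-1.
  rewrite /cmod ComplexField.Normc.normcV -(rmorph_nat (real_complex R)) /=.
  by rewrite expr0n addr0 sqrtr_sqr ger0_norm.
rewrite mulrC ler_pdivrMr ?ltr0n// mul1r; apply: (le_trans (cmod_sum _ _ _)).
by rewrite (eq_bigr (fun=> 1)) ?sumr_const ?card_ord// => j _; exact: cmod_expi.
Qed.

(** Averaging the Zak series over the frequencies [(j / M) v], for a separating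
    [v] and a large [M], keeps the central term [f t], kills a prescribed finite
    set of other translates, and multiplies the rest by factors of modulus at most
    one. The rest is a tail, hence arbitrarily small. *)
Lemma zak_inj t : (forall w, zak f t w = 0) -> f t = 0.
Proof.
move=> z0; have [C C0 [B [h hB]]] := zak_dominated hf.
pose a := C * shift_cost t; have a0 : 0 <= a by rewrite mulr_ge0// shift_cost_ge0.
pose g : _ -> R^o := fun k => a * lattice_weight R k.
have g0 k : 0 <= g k by rewrite mulr_ge0// lattice_weight_ge0.
apply/eqP; rewrite -cmod_eq0 eq_le cmod_ge0 andbT.
apply/ler_addgt0Pr => e e0; rewrite add0r.
have [J0 hJ0] := bounded_psum_tail g0 (hB _ a0) (divr_gt0 e0 (ltr0n _ 2)).
(* The origin is the translate that the average must keep. *)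
pose J := 0 |` J0.
have hJ K : J `<=` K -> psum g K - psum g J <= e / 2.
  move=> sK; apply: le_trans (hJ0 K _); last by apply: fsubset_trans sK; exact: fsubsetUr.
  rewrite lerD2l lerN2 -subr_ge0 psumB ?fsubsetUr//.
  by apply: sumr_ge0 => k _; exact: g0.
have [v hv] := separating_functional J.
pose M := (\max_(k <- J) absz (idot k v)).+1.
have hM k : k \in J -> (absz (idot k v) < M)%N.
  by move=> kJ; exact: (@leq_bigmax_seq _ _ xpredT (fun k => absz (idot k v))).
pose w (j : 'I_M) : 'rV[R]_d := (j%:R / M%:R) *: int_vec R v.
have avg : has_csum (fun k => circle_mean M (idot k v) * f (t + int_vec R k)) 0.
  have := has_csumM (M%:R^-1) (has_csum_sum (fun j => has_csum_zak hf t (w j))).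
  rewrite big1 ?mulr0 => [|j _]; last exact: z0.
  apply: eq_has_csum => k; rewrite /circle_mean -mulrA mulr_suml; congr (_ * _).
  by apply: eq_bigr => j _; rewrite /zak_term /w dotZl dotC dot_int_vec.
have dom k : cmod (circle_mean M (idot k v) * f (t + int_vec R k)) <= g k.
  rewrite cmodM -(mul1r (g k)); apply: ler_pM; rewrite ?cmod_ge0 ?cmod_circle_mean//.
  by rewrite -(cmod_zak_term f t 0); exact: h.
have := has_csum_tail dom avg hJ.
rewrite (big_fsetD1 0) ?fset1U1//= big1_fset => [|k].
  have -> : idot 0 v = 0 by apply: big1 => i _; rewrite mxE mul0r.
  rewrite circle_mean0// mul1r int_vec0 !addr0 add0r.
  by rewrite /cmod normcN -[_ / 2 *+ 2]mulr_natr divfK.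
rewrite !inE => /andP[k0 kJ] _.
rewrite circle_mean_eq0 ?mul0r// absz_gt0.
by rewrite (hv k)//= ?hM// !inE.
Qed.

End ZakInjective.

(** * Zeros of quasi-periodic functions *)

Section QuasiperiodicZero.
Variable R : realType.
Implicit Types (a b w : R[i]).

(** When [a * b^-1] has positive real part, [|w| + w] with [w = a * conj b] has
    half the argument of [a / b]: it is a continuous square root of [a / b], up to
    a positive factor. It replaces a branch of the logarithm. *)
Definition half_turn a b : R[i] := (cmod (a * b^*))%:C + a * b^*.

Lemma half_turn_sqr a b : b != 0 -> 0 < cRe (a * b^*) ->
  exists2 rho : R, 0 < rho & half_turn a b ^+ 2 = rho%:C * (a / b).
Proof.
move=> b0 wpos; set w := a * b^* in wpos.
have cb : 0 < cmod b by rewrite lt_def cmod_eq0 b0 cmod_ge0.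
exists (2 * (cmod w + cRe w) * cmod b ^+ 2).
  by rewrite mulr_gt0 ?exprn_gt0// mulr_gt0//; have := cmod_ge0 w; lra.
have -> : half_turn a b ^+ 2 = (2 * (cmod w + cRe w))%:C * w.
  rewrite /half_turn -/w; have : cmod w ^+ 2 = cRe w ^+ 2 + cIm w ^+ 2.
    by case: (w) => p q /=; rewrite sqr_sqrtr// addr_ge0 ?sqr_ge0.
  rewrite expr2; case: (w) => p q /=; move: (Num.sqrt _) => c hc.
  by apply: complex_eq; rewrite ?cReM ?cImM /=; [nra|ring].
rewrite [in RHS]rmorphM /= -mulrA; congr (_ * _).
by rewrite rmorphXn /= -cmodE sqr_normc /w; field.
Qed.

Lemma ccontinuous_conj (T : topologicalType) (g : T -> R[i]) :
  ccontinuous g -> ccontinuous (fun x => (g x)^*).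
Proof.
move=> [rg ig]; split.
  by rewrite (_ : (fun x => _) = (fun x => cRe (g x)))//; apply/funext => x; case: (g x).
rewrite (_ : (fun x => _) = (fun x => - cIm (g x))); last first.
  by apply/funext => x; case: (g x).
by move=> x; apply: (@cvgN _ R^o _ (nbhs x)); exact: ig.
Qed.

Lemma ccontinuous_half_turn (T : topologicalType) (g h : T -> R[i]) :
  ccontinuous g -> ccontinuous h -> ccontinuous (fun x => half_turn (g x) (h x)).
Proof.
move=> cg ch; have cw := ccontinuousM cg (ccontinuous_conj ch).
split.
  under eq_fun do rewrite cReD /=; move=> x.
  by apply: (@cvgD _ R^o _ (nbhs x)); [exact: (continuous_cmod cw)|exact: cw.1].
by under eq_fun do rewrite cImD /= add0r; exact: cw.2.
Qed.

Lemma continuous_pair (T U V : topologicalType) (g : T -> U) (h : T -> V) :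
  continuous g -> continuous h -> continuous (fun x => (g x, h x)).
Proof. by move=> cg ch x; apply: cvg_pair; [exact: cg|exact: ch]. Qed.

(** The winding number of [r |-> z (s, r)] cannot change with [s] if [z] has no
    zero, but the twist by [expi r] changes it by one between [s = 0] and [s = 1].
    In elementary terms: cutting [0, 1] finely, the product [S] of the half turns
    of the successive quotients [z ((j+1) h, r) / z (j h, r)] is continuous, takes
    the same value at [r = 0] and [r = 1], and has for square a positive multiple
    of [z (1, r) / z (0, r) = expi r]. Then [S r * expi (- r / 2)] has a positive
    square, so its real part does not vanish, although it takes opposite values at
    [r = 0] and [r = 1]. *)
Lemma quasiperiodic_zero (z : R * R -> R[i]) : ccontinuous z ->
  (forall s, z (s, 1) = z (s, 0)) -> (forall r, z (1, r) = expi r * z (0, r)) ->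
  exists x, z x = 0.
Proof.
move=> cz per qper; apply: contrapT => /forallNP nz'.
have nz x : z x != 0 by apply/eqP.
pose K : set (R * R) := `[0, 1] `*` `[0, 1].
have cK : compact K by apply: compact_setX; exact: segment_compact.
pose q (h : R) (x : R * R) := cRe (z (x.1 + h, x.2) * (z x)^* ).
have cq : continuous (fun p : (R * R) * R => q p.2 p.1).
  have c1 : continuous (fun p : (R * R) * R => (p.1.1 + p.2, p.1.2)).
    have c11 : continuous (fun p : (R * R) * R => p.1.1).
      by move=> p; apply: (@cvg_comp _ _ _ fst fst); exact: cvg_fst.
    have c12 : continuous (fun p : (R * R) * R => p.1.2).
      by move=> p; apply: (@cvg_comp _ _ _ fst snd); [exact: cvg_fst|exact: cvg_snd].
    apply: continuous_pair => // p.
    by apply: (@cvgD _ R^o _ (nbhs p)); [exact: c11|exact: cvg_snd].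
  have c2 : continuous (fun p : (R * R) * R => p.1) by move=> p; exact: cvg_fst.
  exact: (ccontinuousM (ccontinuous_comp c1 cz)
           (ccontinuous_conj (ccontinuous_comp c2 cz))).1.
(* The quotients are uniformly close to 1 for small increments of [s]. *)
have q0 x : 0 < q 0 x.
  have := nz x; rewrite /q; case: x => s r /=; rewrite addr0 -sqr_normc cmodE.
  by rewrite -rmorphXn /= -cmod_eq0 => n0; rewrite exprn_gt0// lt_def n0 cmod_ge0.
have [delta /= d0 hdelta] : \forall h \near (0 : R), K `<=` (fun x => 0 < q h x).
  apply: ((compact_near_coveringP K).1 cK R (nbhs 0) (fun h x => 0 < q h x)) => x Kx.
  have /cvgr_gt/(_ 0) := cq (x, 0); exact.
have [n hn] : exists n, n.+1%:R^-1 < delta.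
  exists (Num.truncn delta^-1); rewrite invf_plt ?posrE ?ltr0n//.
  exact: truncnS_gt.
pose h : R := n.+1%:R^-1.
have h0 : 0 < h by rewrite invr_gt0 ltr0n.
pose a (j : nat) r := z (j%:R * h, r).
have step j r : 0 <= r <= 1 -> (j < n.+1)%N -> 0 < cRe (a j.+1 r * (a j r)^* ).
  move=> r01 jn.
  have := hdelta h _ (j%:R * h, r); rewrite /q /a /= -natr1 mulrDl mul1r; apply.
    by rewrite sub0r normrN gtr0_norm.
  split; rewrite /= in_itv //= mulr_ge0 ?(ltW h0)//=.
  by rewrite /h ler_pdivrMr ?ltr0n// mul1r ler_nat ltnW.
pose S m r := \prod_(j < m) half_turn (a j.+1 r) (a j r).
have Ssqr m r : 0 <= r <= 1 -> (m <= n.+1)%N ->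
    exists2 rho : R, 0 < rho & S m r ^+ 2 = rho%:C * (a m r / a 0%N r).
  move=> r01; elim: m => [_|m IH mn].
    by exists 1 => //; rewrite /S big_ord0 expr1n divff ?mulr1 ?rmorph1//; exact: nz.
  have [rho rho0 e] := IH (ltnW mn).
  have [rho' rho'0 e'] := half_turn_sqr (nz _) (step m r r01 mn).
  exists (rho * rho'); first exact: mulr_gt0.
  rewrite /S big_ord_recr /= exprMn e e' rmorphM /=.
  have am : a m r != 0 := nz _; have a0 : a 0%N r != 0 := nz _.
  by rewrite -/(a m r); field; rewrite am a0.
pose G r := S n.+1 r * expi (- (r / 2)).
have G0 r : 0 <= r <= 1 -> cRe (G r) != 0.
  move=> r01; have [rho rho0 e] := Ssqr _ r r01 (leqnn _).
  have : G r ^+ 2 = rho%:C.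
    rewrite /G exprMn e /a mulfV ?pnatr_eq0// qper mul0r mulfK//.
    by rewrite -mulrA expr2 -!expiD -[RHS]mulr1 -(expi0 R); congr (_ * expi _); field.
  move=> /(congr1 (@complex.Re R)); rewrite expr2 cReM /= => e2.
  by apply/eqP => e0; move: e2; rewrite e0 mul0r; have := sqr_ge0 (cIm (G r)); nra.
have cG : continuous (fun r => cRe (G r)).
  have cr (s : R) : continuous (fun r : R => (s, r)).
    by apply: (@continuous_pair R R R (fun=> s) id) => r; [exact: cvg_cst|exact: cvg_id].
  have cS : ccontinuous (S n.+1).
    apply: ccontinuous_prod => j.
    by apply: ccontinuous_half_turn; exact: (ccontinuous_comp (cr _) cz).
  have ce : continuous (fun r : R => - (r / 2)).
    move=> r; apply: (@cvgN _ R^o _ (nbhs r)).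
    by apply: (@cvgM _ _ (nbhs r)); [exact: cvg_id|exact: cvg_cst].
  exact: (ccontinuousM cS (ccontinuous_expi ce)).1.
have G10 : cRe (G 1) = - cRe (G 0).
  have -> : G 1 = - G 0.
    rewrite /G mul0r oppr0 expi0 mulr1 mul1r.
    have -> : expi (- 2^-1 : R) = -1.
      by have := expiNr (2^-1 : R); rewrite expi_half mulrN1 => /eqP; rewrite eqr_oppLR => /eqP.
    rewrite mulrN1; congr (- _); apply: eq_bigr => j _.
    by rewrite /a !per.
  by case: (G 0).
have : exists2 r, r \in `[0, 1]%R & cRe (G r) = 0.
  apply: IVT => //; first exact: continuous_subspaceT.
  rewrite G10 ge_min le_max; have [?|?] := leP 0 (cRe (G 0)).
    by rewrite oppr_le0; apply/andP; split; apply/orP; [right|left].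
  by apply/andP; split; apply/orP; [left|right]; rewrite ?oppr_ge0; apply/ltW.
by move=> [r]; rewrite in_itv /= => /G0/eqP.
Qed.

End QuasiperiodicZero.

(** * Products of trigonometric polynomials that are characters *)

Section TrigonometricMonomial.
Variables (R : realType).

(** The only prime factor of a monomial is the variable. *)
Lemma dvd_monomial (F : fieldType) (P Q : {poly F}) (C : F) (E : nat) :
  C != 0 -> P * Q = C *: 'X^E -> exists2 l : nat, P`_l != 0 & P = P`_l *: 'X^l.
Proof.
move=> C0 PQ.
have : P %| ('X - 0%:P) ^+ E.
  by rewrite subr0 -(dvdpZr _ _ C0) -PQ dvdp_mulr.
move=> /dvdp_exp_XsubCP[l _]; rewrite subr0 => /eqpP[[a a'] /= /andP[a0 a'0] e].
have PE : P = (a^-1 * a') *: 'X^l by rewrite -scalerA -e scalerA mulVf// scale1r.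
by exists l; rewrite PE coefZ coefXn eqxx mulr1// mulf_neq0// invr_eq0.
Qed.

(** An arc of the unit circle has more points than a polynomial has roots. *)
Lemma polynomial_identity_arc (P Q : {poly R[i]}) (e : R) : 0 < e ->
  (forall s : R, 0 < s < e -> P.[expi (- s)] = Q.[expi (- s)]) -> P = Q.
Proof.
move=> e0 h; apply/eqP; rewrite -subr_eq0; apply/eqP.
(* Below 1, the circle parametrisation is injective. *)
pose e' := Num.min e 1; have e'0 : 0 < e' by rewrite lt_min e0 ltr01.
pose s (j : nat) : R := e' / j.+2%:R.
have s0 j : 0 < s j < e'.
  by rewrite divr_gt0 ?ltr0n//= ltr_pdivrMr ?ltr0n// ltr_pMr// ltr1n.
apply: (@roots_geq_poly_eq0 _ _ [seq expi (- s j) | j <- iota 0 (size (P - Q))]).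
- apply/allP => _ /mapP[j _ ->]; rewrite /root hornerD hornerN h ?subrr//.
  have /andP[-> /= sj] := s0 j; apply: lt_le_trans sj _.
  by rewrite ge_min lexx.
- rewrite map_inj_in_uniq ?iota_uniq// => j k _ _ /expi_inj jk.
  have /jk /oppr_inj : `|- s j - - s k| < 1.
    have /andP[? ?] := s0 j; have /andP[? ?] := s0 k.
    have : e' <= 1 by rewrite ge_min lexx orbT.
    by rewrite ltr_norml; lra.
  move=> /(mulfI (lt0r_neq0 e'0))/invr_inj/eqP.
  by rewrite eqr_nat => /eqP[].
- by rewrite size_map size_iota.
Qed.

(** A trigonometric polynomial whose translates multiply to a character is
    itself a single character. Restricted to a line in a separating integer
    direction, it becomes a polynomial in one variable on an arc of the circle; the
    product of the polynomials is a monomial, so each factor is a monomial. All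
    translates have the same spectrum, so all factors have the same exponent, and
    comparing degrees along the separating direction compares the frequencies. *)
Lemma frequency_of_trig_product (n N r : nat) (m : 'I_N -> 'rV[int]_n) (c : 'I_N -> R[i])
    (z : 'I_r -> 'rV[R]_n) (b : 'rV[int]_n) : (0 < r)%N ->
  (forall v : 'rV[int]_n, exists2 C : R[i], C != 0 & exists2 e : R, 0 < e &
    forall s, 0 < s < e ->
      \prod_(j < r) \sum_(k < N) c k * expi (- dot (int_vec R (m k)) (z j + s *: int_vec R v))
      = C * expi (- (s * (idot b v)%:~R))) ->
  exists k, m k *+ r = b.
Proof.
move=> r0 prod_char.
pose S := [seq m k - m k' | k <- enum 'I_N, k' <- enum 'I_N] ++
          [seq m k *+ r - b | k <- enum 'I_N].
have [v sepv] := separating_functional S.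
have vP u : u \in S -> idot u v = 0 -> u = 0.
  by move=> uS e; apply/eqP; apply: contraT => /(sepv _ uS); rewrite e eqxx.
have idotB (u u' : 'rV[int]_n) : idot (u - u') v = idot u v - idot u' v.
  by rewrite /idot -sumrB; apply: eq_bigr => i _; rewrite !mxE mulrBl.
have idotMn (u : 'rV[int]_n) : idot (u *+ r) v = idot u v *+ r.
  by rewrite /idot -sumrMnl; apply: eq_bigr => i _; rewrite mulmxnE mulrnAl.
pose q k := idot (m k) v.
have q_inj k k' : q k = q k' -> m k = m k'.
  move=> e; apply/subr0_eq/vP; last by rewrite idotB -/(q k) e subrr.
  by rewrite mem_cat; apply/orP; left; apply/allpairsP; exists (k, k'); rewrite !mem_enum.
have [C C0 [eps eps0 hC]] := prod_char v.
(* Multiplication by a power of the variable makes all exponents nonnegative. *)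
pose K : nat := (\sum_k absz (q k) + absz (idot b v))%N.
have qK k : 0 <= q k + K%:Z.
  have : (absz (q k) <= K)%N by rewrite /K (bigD1 k)//= -addnA leq_addr.
  lia.
have bK : 0 <= idot b v + (K * r)%:Z.
  have : (absz (idot b v) <= K * r)%N by apply: (@leq_trans K); [exact: leq_addl|exact: leq_pmulr].
  lia.
pose ex k := absz (q k + K%:Z); pose E := absz (idot b v + (K * r)%:Z).
pose phi j k : R[i] := expi (- dot (int_vec R (m k)) (z j)).
pose P j : {poly R[i]} := \sum_(k < N) (c k * phi j k) *: 'X^(ex k).
have PE : \prod_(j < r) P j = C *: 'X^E.
  apply: (polynomial_identity_arc eps0) => s s0.
  have expE (t : int) (T : nat) : 0 <= t + T%:Z ->
      expi (- s) ^+ absz (t + T%:Z) = expi (- (s * t%:~R)) * expi (- s) ^+ T :> R[i].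
    move=> tT; rewrite -!expiMn -expiD; congr expi.
    rewrite -[LHS]mulr_natr -[- s *+ T]mulr_natr natr_absz ger0_norm// intrD.
    by rewrite -pmulrn; ring.
  rewrite horner_prod hornerZ hornerXn expE// mulrA -hC// exprM.
  have -> : (expi (- s) ^+ K) ^+ r = \prod_(j < r) expi (- s) ^+ K :> R[i].
    by rewrite prodr_const card_ord.
  rewrite -big_split; apply: eq_bigr => j _ /=.
  rewrite /P horner_sum mulr_suml; apply: eq_bigr => k _.
  rewrite hornerZ hornerXn expE// dotDr dotZr dot_int_vec opprD expiD /phi.
  by rewrite !mulrA.
have coefP j i : (P j)`_i = \sum_(k < N | ex k == i) c k * phi j k.
  rewrite /P coef_sum [RHS]big_mkcond; apply: eq_bigr => k _.
  by rewrite coefZ coefXn eq_sym; case: eqP; rewrite ?mulr1 ?mulr0.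
have ex_inj k k' : ex k = ex k' -> m k = m k'.
  by move=> e; apply: q_inj; have := qK k; have := qK k'; move: e; rewrite /ex; lia.
(* Monomials collide only when the frequencies coincide, and then the phases
   coincide too: a coefficient vanishes for all translates or for none. *)
have supp j j' i : (P j)`_i = 0 -> (P j')`_i = 0.
  rewrite !coefP; case: (pickP (fun k => ex k == i)) => [k1 /eqP k1i|none]; last first.
    by rewrite !big_pred0.
  have PC l : \sum_(k < N | ex k == i) c k * phi l k =
              (\sum_(k < N | ex k == i) c k) * phi l k1.
    rewrite mulr_suml; apply: eq_bigr => k /eqP ki; congr (_ * _).
    by rewrite /phi (ex_inj k k1)// ki k1i.
  rewrite !PC => /eqP; rewrite mulf_eq0 (negPf (expi_neq0 _)) orbF => /eqP ->.
  by rewrite mul0r.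
pose j0 : 'I_r := Ordinal r0.
have [l Pl0 Pl] : exists2 l : nat, (P j0)`_l != 0 & P j0 = (P j0)`_l *: 'X^l.
  by move: PE; rewrite (bigD1 j0)//=; exact: dvd_monomial C0.
have Pj j : P j = (P j)`_l *: 'X^l.
  apply/polyP => i; rewrite coefZ coefXn; have [->|il] := eqVneq i l.
    by rewrite mulr1.
  by rewrite mulr0; apply: (supp j0); rewrite Pl coefZ coefXn (negPf il) mulr0.
have lE : (l * r)%N = E.
  move: PE; rewrite (eq_bigr _ (fun j _ => Pj j)) scaler_prod prodr_const card_ord -exprM.
  move=> /(congr1 (fun p : {poly R[i]} => size p)); rewrite !size_scale ?size_polyXn//.
    by case.
  by apply/prodf_neq0 => j _; apply: contra Pl0 => /eqP/supp ->.
have [k kl] : exists k, ex k = l.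
  move: Pl0; rewrite coefP; case: (pickP (fun k => ex k == l)) => [k /eqP kl _|none].
    by exists k.
  by rewrite big_pred0// eqxx.
exists k; apply/subr0_eq/vP.
  by rewrite mem_cat; apply/orP; right; apply/mapP; exists k; rewrite ?mem_enum.
rewrite idotB idotMn -/(q k).
have : (absz (q k + K%:Z) * r)%:Z = absz (idot b v + (K * r)%:Z) by rewrite -/E -lE -kl.
by rewrite PoszM !gez0_abs// PoszM mulrDl -[q k *+ r]mulr_natr natz; lia.
Qed.

End TrigonometricMonomial.

(** * Topology of the torus and closures of orbits *)

Lemma closure_sub (U : topologicalType) (A D : set U) :
  closed D -> A `<=` D -> closure A `<=` D.
Proof. by move=> cD AD; rewrite [D](closure_id _).1//; exact: closureS. Qed.

Section Torus.
Variables (R : realType) (n : nat).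
Implicit Types (v w : 'rV[R]_n) (k : 'rV[int]_n) (z h g : torus R n).

HB.instance Definition _ := GRing.isZmodMorphism.Build 'rV[R]_n (torus R n)
  (@torus_pi R n) (@torus_pi_is_zmod_morphism R n).

Lemma torus_piD v w : torus_pi (v + w) = torus_pi v + torus_pi w.
Proof. exact: raddfD. Qed.

Lemma torus_piN v : torus_pi (- v) = - torus_pi v.
Proof. exact: raddfN. Qed.

Lemma torus_piMn v j : torus_pi (v *+ j) = torus_pi v *+ j.
Proof. exact: raddfMn. Qed.

Lemma torus_pi_repr z : torus_pi (repr z) = z.
Proof. exact: reprK. Qed.

Lemma torus_pi_eq0 v : (torus_pi v = 0) <-> exists k, v = int_vec R k.
Proof.
have piE u w : torus_pi u = torus_pi w <-> integer_points (u - w).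
  have -> : integer_points (u - w) = (u - w \in int_lattice R n) by [].
  by rewrite Quotient.idealrBE; split => [e|/eqP//]; apply/eqP.
have -> : (0 : torus R n) = torus_pi 0 by rewrite raddf0.
split=> [/piE/forallP vP|[k ->]]; last first.
  by apply/piE/forallP => i; rewrite !mxE subr0 intr_int.
exists (map_mx Num.floor v); apply/rowP => i; rewrite !mxE.
by move: (vP i); rewrite !mxE subr0 intrEfloor => /eqP.
Qed.

Lemma torus_pi_int k : torus_pi (int_vec R k) = 0.
Proof. by apply/torus_pi_eq0; exists k. Qed.

Lemma continuous_torus_pi : continuous (@torus_pi R n).
Proof. exact: pi_continuous. Qed.

Lemma continuous_torus_fun (U : topologicalType) (g : 'rV[R]_n -> U) :
  (forall v k, g (v + int_vec R k) = g v) -> continuous g -> continuous (torus_fun g).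
Proof.
move=> per cg; apply/quotient_continuous.
rewrite (_ : _ \o _ = g)//; apply/funext => v; exact: torus_funE.
Qed.

Lemma continuous_torus_add z : continuous (fun h => z + h).
Proof.
apply/quotient_continuous.
rewrite (_ : _ \o _ = @torus_pi R n \o (fun v => repr z + v)); last first.
  by apply/funext => v; rewrite /= torus_piD torus_pi_repr.
move=> v; apply: continuous_comp; last exact: continuous_torus_pi.
by apply: (@cvgD _ _ _ (nbhs v)); [exact: cvg_cst|exact: cvg_id].
Qed.

Lemma continuous_torus_opp : continuous (fun h : torus R n => - h).
Proof.
apply/quotient_continuous.
rewrite (_ : _ \o _ = @torus_pi R n \o (fun v => - v)); last first.
  by apply/funext => v; rewrite /= raddfN.
move=> v; apply: continuous_comp; last exact: continuous_torus_pi.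
by apply: (@cvgN _ _ _ (nbhs v)); exact: cvg_id.
Qed.

Definition unit_cube : set 'rV[R]_n := [set v | forall i, `[0, 1]%classic (v ord0 i)].

Lemma compact_unit_cube : compact unit_cube.
Proof. by apply: (@rV_compact R n (fun=> `[0, 1]%classic)) => i; exact: segment_compact. Qed.

Definition frac_part v : 'rV[R]_n := v - int_vec R (map_mx Num.floor v).

Lemma frac_part_cube v : unit_cube (frac_part v).
Proof.
move=> i; rewrite /= in_itv /= !mxE subr_ge0 floor_le_tmp /= lerBlDl.
by apply: ltW; have := floorD1_gt (v ord0 i); rewrite intrD.
Qed.

Lemma torus_pi_frac v : torus_pi (frac_part v) = torus_pi v.
Proof. by rewrite torus_piD torus_piN torus_pi_int subr0. Qed.

Lemma compact_torus : compact [set: torus R n].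
Proof.
have -> : [set: torus R n] = @torus_pi R n @` unit_cube.
  apply/seteqP; split => // z _; exists (frac_part (repr z)); first exact: frac_part_cube.
  by rewrite torus_pi_frac torus_pi_repr.
apply: continuous_compact compact_unit_cube.
exact/continuous_subspaceT/continuous_torus_pi.
Qed.

(** Simultaneous Diophantine approximation: the fractional parts of the
    multiples of [v] accumulate in the compact cube, and the difference of two
    close ones is close to an integer vector. *)
Lemma multiples_near_int v (e : R) : 0 < e ->
  exists2 j : nat, (0 < j)%N & exists k, `|v *+ j - int_vec R k| < e.
Proof.
move=> e0; pose w j := frac_part (v *+ j).
have [x [_ clx]] : unit_cube `&` cluster (w j @[j --> \oo]) !=set0.
  by apply: compact_unit_cube; exists 0%N => // j _; exact: frac_part_cube.
have B : nbhs x (ball x (e / 2)) by apply: nbhsx_ballx; rewrite divr_gt0.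
have [_ [[j0 _ <-]]] : range w `&` ball x (e / 2) !=set0.
  by apply: clx => //; exists 0%N => // j _; exists j.
rewrite -ball_normE /= => b0.
have [_ [[j1 /= j01 <-]]] : [set w j | j in [set j | (j0 < j)%N]] `&` ball x (e / 2) !=set0.
  apply: clx => //; exists j0.+1 => // j /= j0j; by exists j.
rewrite -ball_normE /= => b1.
exists (j1 - j0)%N; first by rewrite subn_gt0.
exists (map_mx Num.floor (v *+ j1) - map_mx Num.floor (v *+ j0)).
rewrite int_vecD int_vecN mulrnBr; last exact: ltnW.
have -> : v *+ j1 - v *+ j0 - (int_vec R (map_mx Num.floor (v *+ j1)) -
   int_vec R (map_mx Num.floor (v *+ j0))) = (x - w j0) - (x - w j1).
  rewrite /w /frac_part; set a := v *+ j1; set b := v *+ j0.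
  set c := int_vec _ _; set d := int_vec _ _.
  by apply/rowP => i; rewrite !mxE; ring.
apply: (le_lt_trans (ler_normB _ _)).
by have := ltrD b0 b1; rewrite -splitr.
Qed.

(** A closed subsemigroup of a compact group is a group: recurrence of the
    multiples of [g] to [0] makes [- g] a limit of forward multiples. So a closed
    condition that propagates forward along the orbit holds on the whole closure. *)
Lemma orbit_closure_sub g (P : set (torus R n)) : closed P -> P 0 ->
  (forall a b, P a -> P b -> P (a + b)) -> P g -> orbit_closure g `<=` P.
Proof.
move=> cP P0 PD Pg.
have Pn j : P (g *+ j).
  by elim: j => [|j IH]; [rewrite mulr0n|rewrite mulrS; exact: PD].
have PN : P (- g).
  apply: cP => U; rewrite -[g]torus_pi_repr -torus_piN => UN.
  have /nbhs_ballP[e /= e0 be] := @continuous_torus_pi (- repr g) U UN.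
  have [[//|j] _ [k hk]] := multiples_near_int (repr g) e0.
  exists (torus_pi (- repr g + (repr g *+ j.+1 - int_vec R k))); split.
    by rewrite !torus_piD !torus_piN torus_piMn torus_pi_int torus_pi_repr subr0 mulrS addKr.
  by apply: be; rewrite -ball_normE /= opprD addrA subrr sub0r normrN.
have Pz (k : int) : P (g *~ k).
  case: k => j; first exact: Pn.
  rewrite NegzE mulrNz -pmulrn -mulNrn.
  by elim: (j.+1) => [|i IH]; [rewrite mulr0n|rewrite mulrS; exact: PD].
by apply: closure_sub => // _ [k _ <-]; exact: Pz.
Qed.

Lemma orbit_closure_closed g : closed (orbit_closure g).
Proof. exact: closed_closure. Qed.

Lemma orbit_closure_gen g : orbit_closure g g.
Proof. by apply: subset_closure; exists 1. Qed.

Lemma orbit_closure0 g : orbit_closure g 0.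
Proof. by apply: subset_closure; exists 0. Qed.

Lemma closed_preimage (U V : topologicalType) (f : U -> V) (D : set V) :
  continuous f -> closed D -> closed (f @^-1` D).
Proof. by move=> /continuous_closedP; exact. Qed.

(** Continuity of the two translations in turn, since the two summands are
    limits independently. *)
Lemma orbit_closureD g a b : orbit_closure g a -> orbit_closure g b -> orbit_closure g (a + b).
Proof.
have sub1 (k : int) : orbit_closure g `<=` (fun b => g *~ k + b) @^-1` orbit_closure g.
  have cl := closed_preimage (@continuous_torus_add (g *~ k)) (@orbit_closure_closed g).
  apply: closure_sub => // _ [l _ <-]; apply: subset_closure => /=.
  by exists (k + l) => //; rewrite mulrzDr.
move=> Ha Hb.
have cl := closed_preimage (@continuous_torus_add b) (@orbit_closure_closed g).
suff : orbit_closure g `<=` (fun a => b + a) @^-1` orbit_closure g.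
  by move=> /(_ a Ha) /=; rewrite addrC.
apply: closure_sub => // _ [k _ <-] /=.
by rewrite addrC; exact: sub1.
Qed.

Lemma orbit_closureN g a : orbit_closure g a -> orbit_closure g (- a).
Proof.
move: a; change (orbit_closure g `<=` (fun a => - a) @^-1` orbit_closure g).
have cl := closed_preimage continuous_torus_opp (@orbit_closure_closed g).
apply: closure_sub => // _ [k _ <-] /=.
by apply: subset_closure; exists (- k) => //; rewrite mulrNz.
Qed.

Lemma orbit_closureMn g j : orbit_closure g (g *+ j).
Proof. by apply: subset_closure; exists j%:Z. Qed.

Lemma compact_orbit_closure g : compact (orbit_closure g).
Proof. exact: subclosed_compact (@orbit_closure_closed g) compact_torus _. Qed.

End Torus.

(** * Averages over the closure of an orbit *)

Section TorusMeasure.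
Variables (R : realType) (n : nat).
Implicit Types (z h g : torus R n).

Lemma open_torus_measurable (A : set (torus R n)) : open A -> measurable A.
Proof. exact: sub_sigma_algebra. Qed.

Lemma closed_torus_measurable (A : set (torus R n)) : closed A -> measurable A.
Proof.
by move=> cA; rewrite -[A]setCK; apply: measurableC; apply: open_torus_measurable; rewrite openC.
Qed.

Lemma continuous_torus_measurable (f : torus R n -> R) : continuous f ->
  measurable_fun [set: torus R n] f.
Proof.
move=> /continuousP cf; apply: (measurability _ (measurable_realfun.RGenOpens.measurableE R)).
move=> _ [_ [a [b ->]] <-]; rewrite setTI.
by apply: open_torus_measurable; apply: cf; exact: interval_open.
Qed.

Lemma torus_add_measurable g : measurable_fun [set: torus R n] (fun h => h + g).
Proof.
apply: (@measurability _ _ (torus R n) (torus R n) _ _ (@open (torus R n))) => //.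
move=> _ [A oA <-]; rewrite setTI.
apply: open_torus_measurable.
have /continuousP := @continuous_torus_add R n g.
by move=> /(_ A oA); under eq_fun do rewrite addrC.
Qed.

Section OrbitAverage.
Variables (g : torus R n) (mH : probability (torus R n) R).
Local Notation H := (orbit_closure g).
Hypothesis haarH : normalized_haar H mH.
Variable L : torus R n -> R.
Hypothesis mL : measurable_fun [set: torus R n] L.
Hypothesis cL : {in H, continuous L}.

Lemma orbit_closure_measurable : measurable H.
Proof. exact: closed_torus_measurable (@orbit_closure_closed _ _ g). Qed.

Lemma orbit_bounded : exists B, forall h, H h -> `|L h| <= B.
Proof.
have : compact (L @` H).
  apply: continuous_compact (@compact_orbit_closure _ _ g).
  exact: continuous_in_subspaceT.
move=> /compact_bounded[M [_ hM]]; exists (M + 1) => h Hh.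
by apply: hM; [rewrite ltrDl|exists h].
Qed.

Lemma orbit_integrable (L' : torus R n -> R) (B : R) :
  measurable_fun [set: torus R n] L' -> (forall h, H h -> `|L' h| <= B) ->
  mH.-integrable H (EFin \o L').
Proof.
move=> mL' hB; apply: measurable_bounded_integrable.
- exact: orbit_closure_measurable.
- by move: haarH.1 => /= ->; rewrite ltry.
- exact: measurable_funS mL'.
- exists B; split; first exact: num_real.
  by move=> M /ltW BM h Hh; exact: le_trans (hB _ Hh) BM.
Qed.

(** Translation by [g] preserves both the subgroup and its invariant measure,
    so [L] and its translate have the same finite integral. *)
Lemma orbit_coboundary_mean :
  mH.-integrable H (EFin \o (fun h => L (h + g) - L h)) /\
  (\int[mH]_(h in H) (L (h + g) - L h)%:E)%E = 0%E.
Proof.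
have [B hB] := orbit_bounded.
have iL := orbit_integrable mL hB.
have mLg : measurable_fun [set: torus R n] (fun h => L (h + g)).
  exact: measurableT_comp mL (torus_add_measurable g).
have Hg h : H (h + g) = H h.
  apply/propext; split => [Hhg|Hh]; last exact: orbit_closureD Hh (@orbit_closure_gen _ _ g).
  rewrite -(addrK g h); apply: orbit_closureD Hhg _.
  by apply: orbit_closureN; exact: orbit_closure_gen.
have iLg : mH.-integrable H (EFin \o (fun h => L (h + g))).
  by apply: (orbit_integrable mLg (B := B)) => h; rewrite -Hg; exact: hB.
split.
  apply: eq_integrable (integrableB orbit_closure_measurable iLg iL).
    exact: orbit_closure_measurable.
  by move=> h _; rewrite /= EFinB.
have -> : (\int[mH]_(h in H) (L (h + g) - L h)%:E =
           \int[mH]_(h in H) ((L (h + g))%:E - (L h)%:E))%E.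
  by apply: eq_integral => h _; rewrite EFinB.
rewrite integralB_EFin//; last exact: orbit_closure_measurable.
have HE : (fun h => h + g) @^-1` H = H by apply/funext => h; exact: Hg.
have -> : (\int[mH]_(h in H) (L (h + g))%:E = \int[mH]_(h in H) (L h)%:E)%E.
  rewrite -[in LHS]HE.
  have mL' := (measurable_realfun.measurable_EFinP _ L).2 mL.
  have := @integral_pushforward _ _ _ _ R _ (torus_add_measurable g) mH H (EFin \o L) mL'.
  rewrite /= HE => /(_ iLg orbit_closure_measurable) <-.
  apply: eq_measure_integral; first exact: torus_add_measurable.
  by move=> mphi A mA _; exact: (haarH.2 g A (@orbit_closure_gen _ _ g) mA).
rewrite subee//; apply: integrable_fin_num iL; exact: orbit_closure_measurable.
Qed.

End OrbitAverage.
End TorusMeasure.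

(** * The relation in Zak coordinates *)

Lemma int_vec_row_mx (R : realType) n1 n2 (a : 'rV[int]_n1) (b : 'rV[int]_n2) :
  int_vec R (row_mx a b) = row_mx (int_vec R a) (int_vec R b).
Proof. exact: map_row_mx. Qed.

Section ZakRelation.
Variables (R : realType) (d N : nat) (f : 'rV[R]_d -> R[i]).
Hypothesis hf : schwartz f.
Implicit Types (t w : 'rV[R]_d) (v : 'rV[R]_(d + d)).

(** Integer shifts change the Zak transform by a phase only, which is why its
    modulus lives on the torus. *)
Lemma zakv_periodic v (k : 'rV[int]_(d + d)) :
  zakv f (v + int_vec R k) = expi (dot (rsubmx v) (int_vec R (lsubmx k))) * zakv f v.
Proof.
rewrite /zakv !linearD /= /int_vec -!map_lsubmx -!map_rsubmx -!/(int_vec R _).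
by rewrite zak_shift_time// zak_shift_freq dotDl dot_int_vec expiD expi_int mulr1.
Qed.

Lemma continuous_zak_modulus : continuous (zak_modulus f).
Proof.
apply: continuous_torus_fun (continuous_cmod (ccontinuous_zakv hf)) => v k.
by rewrite -[X in cmod X]/(zakv f _) zakv_periodic cmodM cmod_expi mul1r.
Qed.

Lemma zak_modulus_pi v : zak_modulus f (torus_pi v) = cmod (zakv f v).
Proof.
rewrite /zak_modulus torus_funE// => {}v k.
by rewrite -[X in cmod X]/(zakv f _) zakv_periodic cmodM cmod_expi mul1r.
Qed.

Lemma zak_modulus_ge0 z : 0 <= zak_modulus f z.
Proof. exact: cmod_ge0. Qed.

Lemma zak_modulus_neq0 : f <> (fun=> 0) -> exists z, zak_modulus f z != 0.
Proof.
move=> f0; apply: contrapT => /forallNP F0; apply: f0; apply/funext => t.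
apply: (zak_inj hf) => w; apply/eqP; rewrite -cmod_eq0 -zakv_row -zak_modulus_pi.
exact/negPn/negP/F0.
Qed.

(** In one time-frequency plane the Zak transform is periodic in frequency and
    picks up the factor [expi r] when time advances by one. *)
Lemma zak_modulus_eq0 : (0 < d)%N -> exists z, zak_modulus f z = 0.
Proof.
move=> d0; pose i0 : 'I_d := Ordinal d0.
pose e : 'rV[int]_d := delta_mx 0 i0.
pose pt (x : R * R) : 'rV[R]_(d + d) :=
  x.1 *: row_mx (int_vec R e) 0 + x.2 *: row_mx 0 (int_vec R e).
pose zeta (x : R * R) := zakv f (pt x).
have ee : dot (int_vec R e) (int_vec R e) = 1.
  rewrite /dot (bigD1 i0)//= big1 => [|i ii0]; first by rewrite !mxE !eqxx mulr1 addr0.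
  by rewrite !mxE (negPf ii0) andbF mul0r.
have [] := @quasiperiodic_zero R zeta; last first.
- by move=> x zx; exists (torus_pi (pt x)); rewrite zak_modulus_pi -/(zeta x) zx cmod0.
- move=> r; rewrite /zeta /pt /= !scale1r scale0r add0r addrC.
  have -> : row_mx (int_vec R e) (0 : 'rV[R]_d) = int_vec R (row_mx e 0).
    by rewrite int_vec_row_mx int_vec0.
  by rewrite zakv_periodic linearZ /= row_mxKr row_mxKl dotZl ee mulr1.
- move=> s; rewrite /zeta /pt /= scale1r scale0r addr0.
  have -> : row_mx (0 : 'rV[R]_d) (int_vec R e) = int_vec R (row_mx 0 e).
    by rewrite int_vec_row_mx int_vec0.
  by rewrite zakv_periodic row_mxKl int_vec0 dotC dot0l expi0 mul1r.
- have cscale (pr : R * R -> R) (u : 'rV[R]_(d + d)) : continuous pr ->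
      continuous (fun x => pr x *: u).
    by move=> cpr x; exact: continuous_comp (cpr x) (@scalel_continuous _ _ u _).
  apply: ccontinuous_comp (ccontinuous_zakv hf) => x.
  apply: (@cvgD _ _ _ (nbhs x)).
    by apply: (cscale fst) => {}x; exact: cvg_fst.
  by apply: (cscale snd) => {}x; exact: cvg_snd.
Qed.

Variables (x y : 'I_N -> 'rV[int]_d) (c : 'I_N -> R[i]) (alpha beta : 'rV[R]_d).
Hypothesis hrel : forall t : 'rV[R]_d,
      \sum_(k < N) c k *
        modulation (int_vec R (y k)) (translation (int_vec R (x k)) f) t
      = modulation beta (translation alpha f) t.

(** The lift of the trigonometric polynomial of the relation to phase space,
    with the frequencies written as single integer vectors. *)
Definition symbol v : R[i] :=
  \sum_(k < N) c k * expi (- dot (int_vec R (row_mx (y k) (x k))) v).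

Lemma symbolE v : symbol v = \sum_(k < N) c k *
  expi (- dot (int_vec R (y k)) (lsubmx v)) * expi (- dot (rsubmx v) (int_vec R (x k))).
Proof.
apply: eq_bigr => k _; rewrite -mulrA -expiD -{1}[v]hsubmxK int_vec_row_mx.
by rewrite dot_row_mx opprD [dot (rsubmx v) _]dotC.
Qed.

Lemma trig_poly_pi v : trig_poly x y c (torus_pi v) = symbol v.
Proof.
rewrite /trig_poly torus_funE => [|{}v k]; rewrite -?symbolE//.
apply: eq_bigr => j _; congr (_ * _).
by rewrite dotDr opprD expiD dot_int_vec -mulrNz expi_int mulr1.
Qed.

(** Integer time-frequency shifts act on the Zak transform as multiplication by
    characters, which add up to the symbol; the remaining shift translates it. *)
Lemma zak_relation t w :
  zak f (t - alpha) (w + beta) = expi (dot beta t) * symbol (row_mx t w) * zak f t w.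
Proof.
apply: has_csum_uniq (has_csum_zak hf _ _) _.
have cs (j : 'I_N) := has_csumM (expi (dot beta t) * (c j *
    expi (- dot (int_vec R (y j)) t) * expi (- dot w (int_vec R (x j)))))
  (has_csum_reindex (subrK (x j)) (addrK (x j)) (has_csum_zak hf t w)).
have := has_csum_sum cs; rewrite -mulr_suml -mulr_sumr.
rewrite symbolE row_mxKl row_mxKr.
apply: eq_has_csum => k.
have := hrel (t + int_vec R k); rewrite /modulation /translation => h.
have -> : zak_term f (t - alpha) (w + beta) k =
    expi (dot beta t) * (expi (- dot w (int_vec R k)) *
     (expi (- dot beta (t + int_vec R k)) * f (t + int_vec R k - alpha))).
  rewrite /zak_term !mulrA -!expiD dotDl dotDr; congr (expi _ * f _); last by rewrite addrAC.
  by ring.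
rewrite -h mulr_sumr mulr_sumr; apply: eq_bigr => j _.
rewrite /zak_term /= int_vecD int_vecN dotDr dotNr opprD opprK expiD.
rewrite dotDr dot_int_vec opprD -mulrNz expiD expi_int mulr1 addrA.
have e1 := expiNr (dot w (int_vec R (x j))).
set a := expi (dot beta t); set b := expi (- dot (int_vec R (y j)) t).
set g := f _; set e := expi (- dot w (int_vec R k)).
have -> : a * (e * (c j * (b * g))) = a * (c j * b * 1) * (e * g) by ring.
by rewrite -e1; ring.
Qed.

Local Notation jump := (row_mx (- alpha) beta).

Lemma zakv_relation v :
  zakv f (v + jump) = expi (dot beta (lsubmx v)) * symbol v * zakv f v.
Proof.
rewrite /zakv !linearD /= row_mxKl row_mxKr zak_relation.
by rewrite hsubmxK.
Qed.

Lemma zakv_iter v r : zakv f (v + jump *+ r) =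
  (\prod_(j < r) (expi (dot beta (lsubmx (v + jump *+ j))) * symbol (v + jump *+ j)))
    * zakv f v.
Proof.
elim: r => [|r IH]; first by rewrite big_ord0 mulr0n addr0 mul1r.
by rewrite mulrSr addrA zakv_relation IH big_ord_recr /= mulrA [_ * \prod_(_ < _) _]mulrC.
Qed.

Lemma zak_modulus_step z : zak_modulus f (z + torus_pi jump) =
  cmod (trig_poly x y c z) * zak_modulus f z.
Proof.
rewrite -[z]torus_pi_repr -torus_piD !zak_modulus_pi trig_poly_pi zakv_relation.
by rewrite !cmodM cmod_expi mul1r.
Qed.

End ZakRelation.

(** * The three kinds of orbit *)

Section OrbitDynamics.
Variables (R : realType) (d N : nat) (f : 'rV[R]_d -> R[i]).
Hypotheses (hf : schwartz f) (hf0 : f <> (fun=> 0)).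
Variables (x y : 'I_N -> 'rV[int]_d) (c : 'I_N -> R[i]) (alpha beta : 'rV[R]_d).
Hypothesis hrel : forall t : 'rV[R]_d,
      \sum_(k < N) c k *
        modulation (int_vec R (y k)) (translation (int_vec R (x k)) f) t
      = modulation beta (translation alpha f) t.
Local Notation jump := (row_mx (- alpha) beta).
Local Notation gamma := (torus_pi jump).
Local Notation H := (orbit_closure gamma).
Local Notation F := (zak_modulus f).
Local Notation p := (trig_poly x y c).

(** The relation propagates zeros forward along the orbit; the set of group
    elements that carry zeros to zeros is a closed semigroup, so it contains all
    of [H]. *)
Lemma zak_modulus_zero_invariant z h : F z = 0 -> H h -> F (z + h) = 0.
Proof.
move=> Fz Hh.
(* As an intersection of preimages of the closed set of zeros, [P] is closed. *)
pose P := \bigcap_(z in [set z | F z = 0]) ((fun h => z + h) @^-1` (F @^-1` [set 0])).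
suff : P h by apply.
apply: (@orbit_closure_sub _ _ gamma P) => //.
- apply: closed_bigI => w _; apply: closed_preimage (@continuous_torus_add _ _ w) _.
  apply: closed_preimage (continuous_zak_modulus hf) _; exact: closed_eq.
- by move=> w /= Fw; rewrite addr0.
- by move=> a b Pa Pb w /= Fw; rewrite addrA; apply: (Pb (w + a)); exact: Pa.
- by move=> w /= Fw; rewrite (zak_modulus_step hf hrel) Fw mulr0.
Qed.

(** Zeros and their complement are both unions of cosets, because [H] is a
    group. *)
Lemma zak_modulus_invariant z h : F z != 0 -> H h -> F (z + h) != 0.
Proof.
move=> Fz Hh; apply: contra Fz => /eqP /zak_modulus_zero_invariant.
by move=> /(_ _ (orbit_closureN Hh)); rewrite addrK => ->.
Qed.

(** A single zero would spread over the torus, contradicting injectivity of the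
    Zak transform. *)
Lemma orbit_not_dense : (0 < d)%N -> H <> [set: torus R (d + d)].
Proof.
move=> d0 HT; have [z Fz] := zak_modulus_eq0 hf d0; have [w /negP] := zak_modulus_neq0 hf hf0.
apply; apply/eqP; rewrite -(subrKC z w); apply: zak_modulus_zero_invariant => //.
by rewrite HT.
Qed.

Lemma torsion_of_finite_orbit : finite_set H ->
  exists2 r : nat, (0 < r)%N & exists k, jump *+ r = int_vec R k.
Proof.
move=> Hfin; apply: contrapT => hno.
have inj : injective (fun j : nat => gamma *+ j).
  have lt i j : gamma *+ i = gamma *+ j -> ~~ (i < j)%N.
    move=> e; apply/negP => ij; apply: hno; exists (j - i)%N; first by rewrite subn_gt0.
    by apply/torus_pi_eq0; rewrite torus_piMn mulrnBr ?e ?subrr// ltnW.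
  move=> i j e; apply/eqP; rewrite eqn_leq leqNgt (lt j i (esym e)) /=.
  by rewrite leqNgt (lt i j e).
apply: infinite_nat.
have -> : [set: nat] = (fun j => gamma *+ j) @^-1` H.
  by apply/seteqP; split => // j _; exact: orbit_closureMn.
by apply: finite_preimage Hfin => i j _ _; exact: inj.
Qed.

Lemma zakv_neq0_line v (u : 'rV[R]_(d + d)) : zakv f v != 0 ->
  exists2 e : R, 0 < e & forall s, 0 < s < e -> zakv f (v + s *: u) != 0.
Proof.
move=> zv; pose g s := cmod (zakv f (v + s *: u)).
have cg : continuous g.
  have cl : continuous (fun s : R => v + s *: u).
    move=> s; apply: (@cvgD _ _ _ (nbhs s)); first exact: cvg_cst.
    exact: (@scalel_continuous _ _ u s).
  exact: (continuous_cmod (ccontinuous_comp cl (ccontinuous_zakv hf))).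
have g0 : 0 < g 0 by rewrite /g scale0r addr0 lt_def cmod_eq0 zv cmod_ge0.
have /nbhs_ballP[e /= e0 he] : \forall s \near (0 : R), 0 < g s.
  by apply: cvgr_gt (cg 0) _ g0.
exists e => // s /andP[s0 se]; rewrite -cmod_eq0 gt_eqF//.
by apply: he; rewrite -ball_normE /= sub0r normrN gtr0_norm.
Qed.

(** A finite orbit closes up after [r] steps, where quasi-periodicity evaluates
    the iterated relation: near a point where the Zak transform does not vanish,
    the product of [r] translates of the symbol is a character. Hence the symbol is
    a character too, its frequency is that of the shift, and the shift is
    integral. *)
Lemma integer_of_finite_orbit : finite_set H -> integer_points (row_mx alpha beta).
Proof.
move=> /torsion_of_finite_orbit[r r0 [k rk]].
have [z Fz] := zak_modulus_neq0 hf hf0.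
pose v0 : 'rV[R]_(d + d) := repr z.
have zv0 : zakv f v0 != 0 by rewrite -cmod_eq0 -zak_modulus_pi// torus_pi_repr.
have rE : alpha *+ r = - lsubmx (int_vec R k) /\ beta *+ r = rsubmx (int_vec R k).
  rewrite -rk !raddfMn /= row_mxKl row_mxKr; split => //.
  by rewrite opprK.
(* [r] times [(beta, alpha)], the frequency of the character. *)
pose b : 'rV[int]_(d + d) := row_mx (rsubmx k) (- lsubmx k).
have [k0 k0b] : exists k0, row_mx (y k0) (x k0) *+ r = b.
  apply: (@frequency_of_trig_product R (d + d) N r (fun k => row_mx (y k) (x k)) c
    (fun j => v0 + jump *+ j)) => // u.
  pose U := int_vec R u.
  pose Q (v : 'rV[R]_(d + d)) := \prod_(j < r) expi (dot beta (lsubmx (v + jump *+ j))).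
  have Q0 v : Q v != 0 by apply/prodf_neq0 => j _; exact: expi_neq0.
  pose C := expi (dot (rsubmx v0) (int_vec R (lsubmx k))) / Q v0.
  exists C; first by rewrite mulf_neq0 ?invr_eq0 ?expi_neq0.
  have [e e0 he] := zakv_neq0_line U zv0; exists e => // s s0.
  have zs := he s s0; set v := v0 + s *: U.
  have : Q v * \prod_(j < r) symbol x y c (v + jump *+ j) =
      expi (dot (rsubmx v) (int_vec R (lsubmx k))).
    apply: (mulIf zs); rewrite -big_split /= -(zakv_iter hf hrel).
    by rewrite rk zakv_periodic.
  have Qv : Q v = Q v0 * expi (s * dot (rsubmx (int_vec R k)) (lsubmx U)).
    have -> : s * dot (rsubmx (int_vec R k)) (lsubmx U) = \sum_(j < r) s * dot beta (lsubmx U).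
      by rewrite sumr_const card_ord -rE.2 -scaler_nat dotZl -mulr_natl; ring.
    rewrite expi_sum -big_split; apply: eq_bigr => j _ /=; rewrite -expiD; congr expi.
    by rewrite /v addrAC [lsubmx (_ + s *: U)]linearD /= [lsubmx (s *: U)]linearZ /= dotDr dotZr.
  have rv : dot (rsubmx v) (int_vec R (lsubmx k)) =
      dot (rsubmx v0) (int_vec R (lsubmx k)) + s * dot (rsubmx U) (int_vec R (lsubmx k)).
    by rewrite /v [rsubmx _]linearD /= [rsubmx (s *: U)]linearZ /= dotDl dotZl.
  have bu : s * (idot b u)%:~R = s * dot (rsubmx (int_vec R k)) (lsubmx U)
      - s * dot (rsubmx U) (int_vec R (lsubmx k)).
    rewrite -dot_int_vec -mulrBr; congr (s * _).
    rewrite -/U -{1}[U]hsubmxK int_vec_row_mx dot_row_mx int_vecN dotNl.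
    by rewrite [dot (int_vec R (lsubmx k)) _]dotC /int_vec map_rsubmx.
  have -> : \prod_(j < r) \sum_(k < N) c k *
      expi (- dot (int_vec R (row_mx (y k) (x k))) (v0 + jump *+ j + s *: U)) =
      \prod_(j < r) symbol x y c (v + jump *+ j).
    by apply: eq_bigr => j _; rewrite /v addrAC.
  rewrite Qv rv expiD bu opprB expiD /C => e1.
  set E := expi (s * dot (rsubmx (int_vec R k)) (lsubmx U)) in e1.
  have EN : expi (- (s * dot (rsubmx (int_vec R k)) (lsubmx U))) * E = 1 by exact: expiNr.
  apply: (mulfI (mulf_neq0 (Q0 v0) (expi_neq0 _ : E != 0))); rewrite e1.
  rewrite -[LHS]mulr1 -EN; have := Q0 v0; move: (Q v0) => q q0.
  by field.
have cancel_r (t : 'rV[R]_d) (m m' : 'rV[int]_d) :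
    t *+ r = int_vec R m' -> m *+ r = m' -> t = int_vec R m.
  move=> tr mr; apply: (@scalerI _ _ (r%:R : R)); first by rewrite pnatr_eq0 -lt0n.
  by rewrite !scaler_nat tr -mr /int_vec raddfMn.
have ky : y k0 *+ r = rsubmx k.
  by have := congr1 lsubmx k0b; rewrite raddfMn /= !row_mxKl.
have kx : x k0 *+ r = - lsubmx k.
  by have := congr1 rsubmx k0b; rewrite raddfMn /= !row_mxKr.
have -> : alpha = int_vec R (x k0).
  by apply: cancel_r kx; rewrite rE.1 int_vecN /int_vec map_lsubmx.
have -> : beta = int_vec R (y k0).
  by apply: cancel_r ky; rewrite rE.2 /int_vec map_rsubmx.
by rewrite -int_vec_row_mx; apply/forallP => i; rewrite mxE intr_int.
Qed.

(** On [H] the integrand is the coboundary of [h |-> ln (F (z + h))], which is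
    continuous because [F] does not vanish on the coset [z + H]. *)
Lemma integral_log_modulus (mH : probability (torus R (d + d)) R) z :
  normalized_haar H mH -> F z != 0 ->
  mH.-integrable H (fun h => log_modulus p (z + h)) /\ Theta p H mH z = 0%E.
Proof.
move=> haarH Fz; pose L h := ln (F (z + h)).
have Fpos h : H h -> 0 < F (z + h).
  by move=> Hh; rewrite lt_def zak_modulus_invariant//= zak_modulus_ge0.
have cF : continuous (fun h => F (z + h)).
  move=> h; apply: continuous_comp; first exact: continuous_torus_add.
  exact: continuous_zak_modulus.
have mL : measurable_fun [set: torus R (d + d)] L.
  apply: (@measurableT_comp _ _ _ _ _ _ (@ln R)); first exact: measurable_realfun.measurable_ln.
  exact: continuous_torus_measurable cF.
have cL : {in H, continuous L}.
  move=> h; rewrite inE => Hh.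
  exact: continuous_comp (cF h) (continuous_ln (Fpos h Hh)).
have LE h : H h -> log_modulus p (z + h) = (L (h + gamma) - L h)%:E.
  move=> Hh; have Fh := Fpos h Hh.
  have Fg : 0 < F (z + (h + gamma)).
    by apply: Fpos; apply: orbit_closureD Hh _; exact: orbit_closure_gen.
  have e : F (z + (h + gamma)) = cmod (p (z + h)) * F (z + h).
    by rewrite addrA (zak_modulus_step hf hrel).
  have p0 : 0 < cmod (p (z + h)) by rewrite -(pmulr_lgt0 _ Fh) -e.
  by rewrite /log_modulus lne_EFin// /L e lnM ?posrE// addrK.
have mHH : measurable H := @orbit_closure_measurable _ _ gamma.
have [i0 m0] := orbit_coboundary_mean haarH mL cL.
split.
  by apply: eq_integrable i0 => // h; rewrite inE => Hh; rewrite /= LE.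
by rewrite /Theta -m0; apply: eq_integral => h; rewrite inE => Hh; exact: LE.
Qed.

(** The logarithm of [F] is bounded on the compact coset [z + H], where the
    orbit of [z] stays. *)
Lemma log_growth_cvg0 z : F z != 0 ->
  (ln (F (z + gamma *+ n)) - ln (F z)) / n%:R @[n --> \oo] --> (0 : R^o).
Proof.
move=> Fz; pose L h := ln (F (z + h)).
have cL : {in H, continuous L}.
  move=> h; rewrite inE => Hh; apply: continuous_comp.
    apply: continuous_comp; first exact: continuous_torus_add.
    exact: continuous_zak_modulus.
  by apply: continuous_ln; rewrite lt_def zak_modulus_invariant//= zak_modulus_ge0.
have [B hB] := orbit_bounded cL.
apply/cvgr0Pnorm_le => e e0.
near=> n.
have n0 : (0 < n)%N by near: n; exists 1%N.
have nB : (B + B) / e <= n%:R.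
  by near: n; exact: nbhs_infty_ger.
rewrite normrM normfV (ger0_norm (ler0n _ n)) ler_pdivrMr ?ltr0n//.
apply: le_trans (ler_normB _ _) _.
have h1 := hB _ (@orbit_closureMn _ _ gamma n).
have h2 := hB _ (@orbit_closure0 _ _ gamma); rewrite /L addr0 in h2.
apply: (le_trans (lerD h1 h2)).
by rewrite mulrC -ler_pdivrMr.
Unshelve. all: by end_near. Qed.

End OrbitDynamics.

Unset Implicit Arguments.

Theorem theorem3p3 (R : realType) (d N : nat) (hd : (1 <= d)%N) (hN : (2 <= N)%N)
    (x y : 'I_N.-1 -> 'rV[int]_d) (alpha beta : 'rV[R]_d)
    (hab : ~~ integer_points (row_mx alpha beta))
    (f : 'rV[R]_d -> R[i]) (hf0 : f <> (fun=> 0)) (hf : schwartz f)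
    (c : 'I_N.-1 -> R[i])
    (hrel : forall t : 'rV[R]_d,
      \sum_(k < N.-1) c k *
        modulation (int_vec R (y k)) (translation (int_vec R (x k)) f) t
      = modulation beta (translation alpha f) t) :
  let Lambda := [set row_mx (int_vec R (x k)) (int_vec R (y k)) |
                   k in [set: 'I_N.-1]] `|` [set row_mx alpha beta] in
  let gamma : torus R (d + d) := torus_pi (row_mx (- alpha) beta) in
  let H := orbit_closure gamma in
  let F := zak_modulus f in
  let p := trig_poly x y c in
  let S := [set z | F z != 0] in
  let dense_case := H = [set: torus R (d + d)] in
  let finite_case := finite_set H in
  let proper_case := infinite_set H /\ H <> [set: torus R (d + d)] in
  [/\ [\/ [/\ dense_case, ~ finite_case & ~ proper_case],
          [/\ ~ dense_case, finite_case & ~ proper_case] |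
          [/\ ~ dense_case, ~ finite_case & proper_case]],
      ~ dense_case,
      finite_case ->
        [/\ rational_vec (row_mx alpha beta),
            ~~ integer_points (row_mx alpha beta),
            (exists2 L : set 'rV[R]_(d + d),
               full_rank_lattice L & Lambda `<=` L)
          & f = (fun=> 0)],
      proper_case ->
        [/\ S !=set0, open S, invariant_under H S
          & forall mH : probability (torus R (d + d)) R, normalized_haar H mH ->
              forall z, S z ->
              [/\ mH.-integrable H (fun h => log_modulus p (z + h)),
                  ((ln (F (z + gamma *+ n)) - ln (F z)) / n%:R)%:E
                    @[n --> \oo] --> Theta p H mH z
                & Theta p H mH z = 0%E]]
    & proper_case /\
        (forall mH : probability (torus R (d + d)) R, normalized_haar H mH ->
           forall z, S z -> Theta p H mH z = 0%E)].
Proof.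
move=> Lambda gamma H F p S dense_case finite_case proper_case.
have ndense : ~ dense_case := orbit_not_dense hf hf0 hrel hd.
have nfinite : ~ finite_case.
  by move=> /(integer_of_finite_orbit hf hf0 hrel); exact/negP.
have proper : proper_case by [].
have Theta0 (mH : probability (torus R (d + d)) R) : normalized_haar H mH ->
    forall z, S z -> Theta p H mH z = 0%E.
  by move=> haarH z Sz; have [] := integral_log_modulus hf hrel haarH Sz.
split=> //; first exact: Or33.
move=> _; split.
- by have [z Fz] := zak_modulus_neq0 hf hf0; exists z.
- have -> : S = F @^-1` [set~ 0] by apply/seteqP; split => z /eqP.
  apply: open_comp; first by move=> z _; exact: continuous_zak_modulus.
  by rewrite openC; exact: closed_eq.
- by move=> z h; exact: zak_modulus_invariant.
- move=> mH haarH z Sz; split; last exact: Theta0.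
    by have [] := integral_log_modulus hf hrel haarH Sz.
  rewrite Theta0//; apply: cvg_EFin; first exact: nearW.
  exact (@log_growth_cvg0 _ _ _ _ hf _ _ _ _ _ hrel _ Sz).
Qed.
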